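(* Let $\mathbf{X} \in \mathcal{X} \subseteq \mathbb{R}^d$ and $\mathbf{Y} \in \mathcal{Y} \subseteq \mathbb{R}^k$ be random vectors such that the conditional pdf of $\mathbf{Y}$ given $\mathbf{X}$ has the exponential family form $$f_{\mathbf{Y}|\mathbf{X}}(\mathbf{y}|\mathbf{x}) = h(\mathbf{y})\, e^{\langle \mathbf{x}, \mathbf{T}(\mathbf{y})\rangle - \phi(\mathbf{x})}, \qquad \mathbf{y}\in\mathcal{Y},\ \mathbf{x}\in\mathcal{X},$$ and assume the regularity conditions (R) listed in the context. Suppose that the matrix $\mathbf{J}_{\mathbf{y}}\mathbf{T}(\mathbf{y})$ is invertible $P_{\mathbf{Y}}$-almost surely. Then $$\mathrm{MMSE}(\mathbf{X}|\mathbf{Y}) = \mathbb{E}\left[ \left(\mathbf{J}_{\mathbf{Y}}\mathbf{T}(\mathbf{Y})\right)^{-1} \mathbf{J}_{\mathbf{Y}} \mathbb{E}[\mathbf{X}|\mathbf{Y}] \right].$$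
   Context: MMSE matrix: $\mathrm{MMSE}(\mathbf{X}|\mathbf{Y}) = \mathbb{E}\left[(\mathbf{X}-\mathbb{E}[\mathbf{X}|\mathbf{Y}])(\mathbf{X}-\mathbb{E}[\mathbf{X}|\mathbf{Y}])^{\mathsf T}\right]$. $\mathbf{J}_{\mathbf{Y}}\mathbf{T}(\mathbf{Y})$ and $\mathbf{J}_{\mathbf{Y}}\mathbb{E}[\mathbf{X}|\mathbf{Y}]$ denote the Jacobians of $\mathbf{y}\mapsto\mathbf{T}(\mathbf{y})$ and $\mathbf{y}\mapsto\mathbb{E}[\mathbf{X}|\mathbf{Y}=\mathbf{y}]$ evaluated at $\mathbf{Y}$. Jacobian convention: for $\mathbf{f}:\mathbb{R}^n\to\mathbb{R}^m$, $\mathbf{J}_{\mathbf{x}}\mathbf{f}(\mathbf{x}) = [\nabla_{\mathbf{x}} f_1(\mathbf{x}) \ \cdots \ \nabla_{\mathbf{x}} f_m(\mathbf{x})] \in \mathbb{R}^{n\times m}$, where $\nabla_{\mathbf{x}} f_i$ is the gradient as a column vector (the transpose of the usual Jacobian). Invertibility of the $k\times d$ matrix $\mathbf{J}_{\mathbf{y}}\mathbf{T}(\mathbf{y})$ presupposes $k=d$. Exponential family: $\mathbf{T}:\mathcal{Y}\to\mathbb{R}^d$ is the sufficient statistic, $\phi:\mathcal{X}\to\mathbb{R}$ the log-partition function, $h:\mathcal{Y}\to[0,\infty)$ the base measure. Standing assumptions: $\mathcal{Y}$ is open, $h$ is absolutely continuous with respect to Lebesgue measure, and $\mathbf{T}$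 is analytic. Regularity conditions (R): for all $\mathbf{y}\in\mathcal{Y}$, $\mathbb{E}[\|\mathbf{X}\| \mid \mathbf{Y}=\mathbf{y}]<\infty$ and $\mathbb{E}[\|\mathbf{X}\|^2 \mid \mathbf{Y}=\mathbf{y}]<\infty$; and $\mathbf{y}\mapsto \mathbf{x}\,\iota_{P_{\mathbf{X},\mathbf{Y}}}(\mathbf{x};\mathbf{y})$ and $\mathbf{y}\mapsto f_{\mathbf{Y}|\mathbf{X}}(\mathbf{y}|\mathbf{x})$ are absolutely continuous for every $\mathbf{x}$. Here $\iota_{P_{\mathbf{X},\mathbf{Y}}}(\mathbf{x};\mathbf{y}) = \log \frac{f_{\mathbf{Y}|\mathbf{X}}(\mathbf{y}|\mathbf{x})}{f_{\mathbf{Y}}(\mathbf{y})}$ is the information density, with $f_{\mathbf{Y}}$ the marginal pdf of $\mathbf{Y}$. *)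

(* Defs.v *)
From HB Require Import structures.
From mathcomp Require Import all_boot all_order all_algebra.
From mathcomp Require Import all_classical all_reals all_analysis.
From mathcomp Require Import measurable_realfun.
Set Implicit Arguments.
Unset Strict Implicit.
Unset Printing Implicit Defensive.
Import Order.TTheory GRing.Theory Num.Theory.
Import numFieldNormedType.Exports.
Local Open Scope classical_set_scope.
Local Open Scope ring_scope.

Section borel_rV.
Context (R : realType) (n : nat).
Let G : set (set 'rV[R]_n) := open.

HB.instance Definition _ := @isMeasurable.Build (sigma_display G) 'rV[R]_n
  <<s G >> (@sigma_algebra0 _ setT G) (@sigma_algebraC _ G)
  (@sigma_algebra_bigcup _ setT G).

End borel_rV.

Section lebesgue_rV.
Context {R : realType}.

Definition rV_cons n (p : R * 'rV[R]_n) : 'rV[R]_n.+1 :=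
  row_mx (p.1%:M : 'rV_1) p.2.

Lemma rV_cons0 n p : @rV_cons n p 0 0 = p.1.
Proof.
have -> : (0 : 'I_n.+1) = lshift n (0 : 'I_1) by apply: val_inj.
by rewrite [LHS]row_mxEl mxE eqxx.
Qed.

Lemma rV_consS n p (i : 'I_n) : rV_cons p 0 (lift 0 i) = p.2 0 i.
Proof.
have -> : lift 0 i = rshift 1 i by apply: val_inj.
by rewrite [LHS]row_mxEr.
Qed.

Definition rV_uncons n (v : 'rV[R]_n.+1) : R * 'rV[R]_n :=
  (v 0 0, \row_j v 0 (lift 0 j)).

Lemma rV_consK n : cancel (@rV_cons n) (@rV_uncons n).
Proof.
move=> [x v]; rewrite /rV_uncons rV_cons0; congr pair.
by apply/rowP => i; rewrite mxE rV_consS.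
Qed.

Lemma rV_unconsK n : cancel (@rV_uncons n) (@rV_cons n).
Proof.
move=> v; apply/rowP => i; case: (unliftP 0 i) => [k ->|->].
  by rewrite rV_consS mxE.
by rewrite rV_cons0.
Qed.

Lemma open_measurable_rV n (A : set 'rV[R]_n) : open A -> measurable A.
Proof. by move=> oA; exact: sub_sigma_algebra. Qed.

(* Rational sup-norm balls form a countable basis of ['rV[R]_n]. *)
Lemma open_rV_bigcup n (A : set 'rV[R]_n) : open A ->
  A = \bigcup_(q in [set q : rat * 'rV[rat]_n |
      ball (map_mx ratr q.2 : 'rV[R]_n) (ratr q.1 : R) `<=` A])
    ball (map_mx ratr q.2 : 'rV[R]_n) (ratr q.1 : R).
Proof.
move=> oA; apply/seteqP; split => [v Av|v [q /= qA qv]]; last exact: qA.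
have /nbhs_ballP[e /= e0 eA] : nbhs v A by exact: open_nbhs_nbhs.
have [r] : exists r : rat, (0 : R) < ratr r < e / 2.
  have /rat_in_itvoo[r] : 0 < e / 2 by rewrite divr_gt0.
  by rewrite in_itv /= => rP; exists r.
move=> /andP[r0 re].
have /choice[c cP] : forall i : 'I_n, exists q : rat, `|ratr q - v 0 i| < ratr r.
  move=> i; have /rat_in_itvoo[q] : v 0 i < v 0 i + ratr r by rewrite ltrDl.
  rewrite in_itv /= => /andP[q1 q2]; exists q.
  by rewrite ger0_norm ?subr_ge0 1?ltW// ltrBlDl.
have bv : ball (map_mx ratr (\row_i c i) : 'rV[R]_n) (ratr r : R) v.
  by split => // i j; rewrite ord1 !mxE; exact: cP.
exists (r, \row_i c i) => //= w bw; apply: eA.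
apply: (@ball_split _ _ (map_mx ratr (\row_i c i) : 'rV[R]_n)).
  by apply: ball_sym; apply: le_ball bv; exact: ltW.
by apply: le_ball bw; exact: ltW.
Qed.

Lemma measurable_rV_cons n : measurable_fun setT (@rV_cons n).
Proof.
apply: measurability => //.
move=> _ [B oB <-]; rewrite setTI (open_rV_bigcup oB) preimage_bigcup.
rewrite bigcup_mkcond; apply: countable_bigcupT_measurable => [|q].
  exact: countableP.
case: ifP => // _.
rewrite (_ : _ @^-1` _ =
  ball (ratr (q.2 0 0) : R) (ratr q.1) `*`
  ball ((\row_j ratr (q.2 0 (lift 0 j))) : 'rV[R]_n) (ratr q.1)); last first.
  apply/seteqP; split=> [[x v] /= [e0 H]|[x v] /= [H1 [e0 H2]]].
    split; first by have := H 0 0; rewrite mxE rV_cons0.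
    split => // i j; have := H i (lift 0 j).
    by rewrite !ord1 rV_consS !mxE.
  split => // i j; rewrite ord1; case: (unliftP 0 j) => [k ->|->].
    by rewrite rV_consS mxE; have := H2 0 k; rewrite !mxE.
  by rewrite rV_cons0 mxE.
apply: measurableX; first by apply: open_measurable; exact: ball_open.
by apply: open_measurable_rV; exact: ball_open.
Qed.

Lemma measurable_rV_uncons n : measurable_fun setT (@rV_uncons n).
Proof.
apply: measurable_fun_pair.
  apply: (measurability _ (RGenOpens.measurableE R)) => // _ [_ [a [b ->]] <-].
  rewrite setTI; apply: open_measurable_rV; apply: open_comp; last exact: interval_open.
  by move=> v _; exact: coord_continuous.
apply: measurability => // _ [B oB <-]; rewrite setTI; apply: open_measurable_rV.
apply: open_comp oB => v _ A /nbhs_ballP[e /= e0 eA].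
apply/nbhs_ballP; exists e => // w [_ vw]; apply: eA; split => // i j.
by rewrite !mxE; exact: vw.
Qed.

Section rV_cons_measure.
Context n (m : {sigma_finite_measure set 'rV[R]_n -> \bar R}).

Let mu : {sigma_finite_measure set (measurableTypeR R) -> \bar R} :=
  @lebesgue_measure R.

Definition rV_cons_measure : set 'rV[R]_n.+1 -> \bar R :=
  pushforward (mu \x m)%E (@rV_cons n).

Let pf := measure_function_pushforward__canonical__measure_function_Measure
  (mu \x m)%E (@measurable_rV_cons n).

HB.instance Definition _ := isMeasure.Build _ _ _ rV_cons_measure
  (measure0 pf) (measure_ge0 pf) (@measure_semi_sigma_additive _ _ _ pf).

(* The canonical sigma-finiteness instance of [\x] in the library is shadowed
   by its subprobability instance, hence the direct proof. *)
Let rV_cons_measure_sigma_finite : sigma_finite setT rV_cons_measure.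
Proof.
have /sigma_finiteP[F [TF ndF Foo]] := sigma_finiteT mu.
have /sigma_finiteP[G [TG ndG Goo]] := sigma_finiteT m.
exists (fun k => @rV_uncons n @^-1` (F k `*` G k)).
  apply/esym; rewrite -subTset => v _.
  have [i _ Fi] : (\bigcup_i F i) (rV_uncons v).1 by rewrite -TF.
  have [j _ Gj] : (\bigcup_i G i) (rV_uncons v).2 by rewrite -TG.
  exists (maxn i j) => //; split.
    by move: Fi; exact/subsetPset/ndF/leq_maxl.
  by move: Gj; exact/subsetPset/ndG/leq_maxr.
move=> k; have [mF Fk] := Foo k; have [mG Gk] := Goo k; split.
  rewrite -[X in measurable X]setTI.
  by apply: measurable_rV_uncons => //; exact: measurableX.
rewrite /rV_cons_measure /pushforward -comp_preimage (_ : _ \o _ = id).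
  by rewrite preimage_id product_measure1E// lte_mul_pinfty// ge0_fin_numE.
by apply/funext => p /=; rewrite rV_consK.
Qed.

HB.instance Definition _ := Measure_isSigmaFinite.Build _ _ _ rV_cons_measure
  rV_cons_measure_sigma_finite.

End rV_cons_measure.

Fixpoint lebesgue_rV n : {sigma_finite_measure set 'rV[R]_n -> \bar R} :=
  match n with
  | 0 => \d_(0 : 'rV[R]_0)
  | n.+1 => rV_cons_measure (lebesgue_rV n)
  end.

Lemma measurable_rV_box n (A : 'I_n -> set R) :
  (forall i, measurable (A i)) -> measurable [set v : 'rV[R]_n | forall i, A i (v 0 i)].
Proof.
elim: n A => [|n IHn] A mA.
  by rewrite (_ : mkset _ = setT)//; apply/seteqP; split => // v _ [].
rewrite (_ : mkset _ = setT `&` @rV_uncons n @^-1`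
    (A 0 `*` [set v : 'rV[R]_n | forall i, A (lift 0 i) (v 0 i)])).
  apply: measurable_rV_uncons => //; apply: measurableX => //.
  by apply: (IHn (fun i => A (lift 0 i))) => i.
rewrite setTI; apply/seteqP; split => [v /= Av|v /= [A0 AS] i].
  by split => // i; rewrite mxE.
case: (unliftP 0 i) => [j ->|->//].
by have := AS j; rewrite mxE.
Qed.

Lemma lebesgue_rV_box n (A : 'I_n -> set R) :
  (forall i, measurable (A i)) ->
  lebesgue_rV n [set v : 'rV[R]_n | forall i, A i (v 0 i)] =
  (\big[mule/1]_(i < n) @lebesgue_measure R (A i))%E.
Proof.
elim: n A => [|n IHn] A mA.
  by rewrite big_ord0 /= diracE mem_set//; case.
rewrite big_ord_recl /= -(IHn (fun i => A (lift 0 i)))//.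
rewrite -product_measure1E; first last.
- exact: (@measurable_rV_box n (fun i => A (lift 0 i))).
- exact: mA.
rewrite /rV_cons_measure /pushforward; congr (_ _); apply/seteqP; split => [[x v] /= Av|[x v] /= [A0 AS] i].
  split => [|i /=]; first by have := Av 0; rewrite rV_cons0.
  by have := Av (lift 0 i); rewrite rV_consS.
by case: (unliftP 0 i) => [j ->|->]; rewrite ?rV_cons0 ?rV_consS.
Qed.

End lebesgue_rV.

Section analysis_rV.
Context {R : realType}.

Definition dot n (u v : 'rV[R]_n) : R := \sum_i u 0 i * v 0 i.

(* The library norm on ['rV[R]_n] is the sup norm. *)
Definition enorm n (u : 'rV[R]_n) : R := Num.sqrt (dot u u).

(* [f] is the sum of an absolutely convergent power series
   [\sum_alpha (v ^ alpha) *: c alpha] around [y0]; the sum over multi-indices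
   is taken along the cubes [alpha_i < N]. *)
Definition analytic_at n (V : normedModType R) (f : 'rV[R]_n -> V)
    (y0 : 'rV[R]_n) : Prop :=
  exists (c : ('I_n -> nat) -> V) (r : R), [/\ 0 < r,
    exists M : R, forall N : nat,
      \sum_(alpha : {ffun 'I_n -> 'I_N})
        `|c (fun i => alpha i : nat)| * r ^+ (\sum_i alpha i)%N <= M &
    forall v : 'rV[R]_n, `|v| < r ->
      (fun N : nat => \sum_(alpha : {ffun 'I_n -> 'I_N})
        (\prod_i v 0 i ^+ alpha i) *: c (fun i => alpha i : nat))
      @ \oo --> f (y0 + v)].

Definition analytic_on n (V : normedModType R) (U : set 'rV[R]_n)
    (f : 'rV[R]_n -> V) : Prop :=
  forall y, U y -> analytic_at f y.

(* Finite families of non-overlapping subintervals of [a, b] are listed from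
   left to right. *)
Definition abs_continuous_itv (V : normedModType R) (a b : R) (g : R -> V)
    : Prop :=
  forall e : R, 0 < e -> exists2 delta : R, 0 < delta &
    forall s : seq (R * R),
      all (fun p => (a <= p.1) && (p.1 <= p.2) && (p.2 <= b)) s ->
      pairwise (fun p q => p.2 <= q.1) s ->
      \sum_(p <- s) (p.2 - p.1) < delta ->
      \sum_(p <- s) `|g p.2 - g p.1| < e.

(* Absolute continuity of a function of several variables on an open set [U],
   in the sense "absolutely continuous on lines": [f] is continuous on [U] and
   absolutely continuous on each compact segment of [U] carried by almost every
   line parallel to a coordinate axis. A set of such lines is null iff its
   union is Lebesgue null, whence the quantification over almost every [y]. For
   [n = 1] this is absolute continuity on each compact interval of [U]. *)
Definition abs_continuous n (V : normedModType R) (U : set 'rV[R]_n)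
    (f : 'rV[R]_n -> V) : Prop :=
  {within U, continuous f} /\
  {ae lebesgue_rV n, forall y : 'rV[R]_n, forall (i : 'I_n) (a b : R),
    (forall t, t \in `[a, b] -> U (y + t *: delta_mx 0 i)) ->
    abs_continuous_itv a b (fun t => f (y + t *: delta_mx 0 i))}.

End analysis_rV.

Section expectation_mx.
Context {R : realType} {disp : measure_display} {Omega : measurableType disp}.
Variable P : probability Omega R.

(* The integral of the library has a (conventional) value for every function;
   [E[Z]] is meaningful when [Z^+] or [Z^-] has a finite integral. *)
Definition has_expectation (Z : Omega -> R) : Prop :=
  (\int[P]_w (Num.max (Z w) 0)%:E < +oo)%E \/
  (\int[P]_w (Num.max (- Z w) 0)%:E < +oo)%E.

(* Entries are extended reals: a diagonal entry may be [+oo]. *)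
Definition expectation_mx m n (Z : Omega -> 'M[R]_(m, n)) : 'M[\bar R]_(m, n) :=
  \matrix_(i, j) ('E_P[fun w => Z w i j])%E.

End expectation_mx.

Section conditional_expectation.
Context {R : realType} {disp : measure_display} {Omega : measurableType disp}.
Variable P : probability Omega R.
Context {n k : nat}.
Variable X : Omega -> 'rV[R]_n.
(* [f x y] is the conditional pdf of [Y] at [y] given [X = x]. *)
Variable f : 'rV[R]_n -> 'rV[R]_k -> R.

Definition marginal_pdf (y : 'rV[R]_k) : \bar R := ('E_P[fun w => f (X w) y])%E.

Definition info_density (x : 'rV[R]_n) (y : 'rV[R]_k) : R :=
  ln (f x y / fine (marginal_pdf y)).

(* [E[g(X) | Y = y]], the integral of [g] against the conditional law of [X]
   given [Y = y], whose density with respect to the law of [X] is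
   [f x y / f_Y y] by Bayes' rule. *)
Definition cond_expectation (g : 'rV[R]_n -> R) (y : 'rV[R]_k) : \bar R :=
  ('E_P[fun w => (g (X w) * (f (X w) y / fine (marginal_pdf y)))%R])%E.

Definition cond_mean (y : 'rV[R]_k) : 'rV[R]_n :=
  \row_i fine (cond_expectation (fun x => x 0 i) y).

(* With row vectors, [u u^T] for the column vector [u] reads [u^T *m u]. *)
Definition MMSE (Y : Omega -> 'rV[R]_k) : 'M[\bar R]_n :=
  expectation_mx P (fun w =>
    (X w - cond_mean (Y w))^T *m (X w - cond_mean (Y w))).

End conditional_expectation.

Section exponential_family.
Context {R : realType} {n k : nat}.

(* The pdf is with respect to Lebesgue measure: the base measure [h(y) dy] is
   given through its density [h]. *)
Definition is_conditional_pdf (disp : measure_display)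
    (Omega : measurableType disp) (P : probability Omega R)
    (X : {RV P >-> 'rV[R]_n}) (Y : {RV P >-> 'rV[R]_k}) (calY : set 'rV[R]_k)
    (f : 'rV[R]_n -> 'rV[R]_k -> R) : Prop :=
  forall (A : set 'rV[R]_n) (B : set 'rV[R]_k), measurable A -> measurable B ->
    P (X @^-1` A `&` Y @^-1` B) =
    (\int[P]_(w in X @^-1` A)
       \int[lebesgue_rV k]_(y in calY `&` B) (f (X w) y)%:E)%E.

Definition exp_family_pdf (h : 'rV[R]_k -> R) (T : 'rV[R]_k -> 'rV[R]_n)
    (phi : 'rV[R]_n -> R) (x : 'rV[R]_n) (y : 'rV[R]_k) : R :=
  h y * expR (dot x (T y) - phi x).

Definition is_log_partition (calX : set 'rV[R]_n) (calY : set 'rV[R]_k)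
    (h : 'rV[R]_k -> R) (T : 'rV[R]_k -> 'rV[R]_n) (phi : 'rV[R]_n -> R)
    : Prop :=
  forall x, calX x ->
    (\int[lebesgue_rV k]_(y in calY) (h y * expR (dot x (T y)))%:E)%E =
    (expR (phi x))%:E.

(* [marginal_pdf y < +oo] expresses that the marginal pdf is real valued.
   Where it vanishes the conditional law given [Y = y] and the information
   density are undefined: there the two moment bounds hold trivially
   (division by 0 gives 0), and the information density is only considered on
   the set where the marginal pdf is positive. *)
Record regularity (disp : measure_display) (Omega : measurableType disp)
    (P : probability Omega R) (X : Omega -> 'rV[R]_n)
    (calX : set 'rV[R]_n) (calY : set 'rV[R]_k)
    (f : 'rV[R]_n -> 'rV[R]_k -> R) : Prop := {
  marginal_pdf_fin : forall y, calY y -> (marginal_pdf P X f y < +oo)%E ;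
  cond_norm_fin : forall y, calY y ->
    (cond_expectation P X f (@enorm R n) y < +oo)%E ;
  cond_norm2_fin : forall y, calY y ->
    (cond_expectation P X f (fun x => (enorm x ^+ 2)%R) y < +oo)%E ;
  info_density_ac : forall x, calX x ->
    abs_continuous [set y | calY y /\ (0 < marginal_pdf P X f y)%E]
      (fun y => info_density P X f x y *: x) ;
  cond_pdf_ac : forall x, calX x -> abs_continuous calY (f x)
}.

End exponential_family.

(* Main.v *)
(* The conditional law of X given Y = y has a density with respect to the law of
   X proportional to exp (<x, T y> - phi x), so that where h > 0 the conditional
   mean is m = (grad log G) o T, with G t := E[exp (<X, t> - phi X)] the moment
   generating function of a tilted law of X. Differentiating log G once more
   gives J m = J T * Cov(X | Y = y), hence J T^-1 * J m = Cov(X | Y = y), and the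
   tower property gives the theorem.

   Differentiating G at T y needs an exponential moment, i.e., T y has to be
   interior to the domain of G. As J T y is invertible, T maps y plus or minus
   small suitable vectors to a perturbed cross-polytope centered at T y, on
   whose vertices G is finite, and exp (eta * |x|) is bounded by the sum of the
   exponentials of the linear forms given by these vertices. *)
Require Import Defs.
From HB Require Import structures.
From mathcomp Require Import all_boot all_order all_algebra.
From mathcomp Require Import all_classical all_reals all_analysis.
From mathcomp Require Import measurable_realfun ring lra.
Set Implicit Arguments.
Unset Strict Implicit.
Unset Printing Implicit Defensive.
Import Order.TTheory GRing.Theory Num.Theory.
Import numFieldNormedType.Exports.
Local Open Scope classical_set_scope.
Local Open Scope ring_scope.

(** * Differentials and analytic maps *)

(** Three obstacles shape the proof. Entries of the covariance need not be integrable: an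
    expectation only has to have one finite part, so the tower property is proved by comparing
    positive and negative parts, with values in the extended reals. Measurability is scarce: the
    log-partition function is measurable only along [X], through its defining integral, while [h]
    and [T] are controlled only on [calY]; hence a joint density on [Omega] times the space of [Y],
    with [h] and [T] extended by 0. The Jacobian of the conditional mean is identified only almost
    surely, so the product in the theorem is replaced by a measurable conditional covariance, and
    the exchange rests on the integral being a supremum over simple functions. Finally, a derivative
    at [y] takes the formula for the mean on a neighborhood of [y]; continuity of the conditional
    pdf keeps [h] positive there. *)

Section row_differential.
Context {R : realType}.

(** A quadratic remainder is what both later sources of differentiability provide: power series and
    tilted integrals. *)
Lemma is_diff_quadratic (V W : normedModType R) (f : V -> W)
    (L : {linear V -> W}) (x : V) (C : R) :
  continuous L ->
  (\forall v \near 0, `|f (v + x) - (f x + L v)| <= C * `|v| ^+ 2) ->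
  is_diff x f L.
Proof.
move=> cL fL.
have fo : f \o shift x = cst (f x) + L +o_ 0 id.
  apply/eqaddoP => _/posnumP[e].
  (* [C] carries no sign, hence this positive denominator. *)
  have C1 : 0 < e%:num / (`|C| + 1) by rewrite divr_gt0// ltr_wpDl.
  near=> v.
  rewrite /= (_ : (_ - _) v = f (v + x) - (f x + L v))//.
  have /le_trans : `|f (v + x) - (f x + L v)| <= C * `|v| ^+ 2 by near: v.
  apply; rewrite expr2 mulrA ler_wpM2r//.
  apply: (@le_trans _ _ ((`|C| + 1) * `|v|)).
    by rewrite ler_wpM2r// (le_trans (ler_norm C))// lerDl.
  by rewrite -ler_pdivlMl ?ltr_wpDl// mulrC; near: v; exact: nbhs0_le.
have dE := diff_unique cL fo.
by apply: DiffDef => //; apply/diff_locallyP; rewrite dE.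
Unshelve. all: by end_near. Qed.

(** Needed because the quotient formula for the conditional mean holds only near a point with
    positive [h]. *)
Lemma near_eq_is_diff (V W : normedModType R) (f g : V -> W) (df : V -> W)
    (x : V) :
  (\forall y \near x, f y = g y) -> is_diff x f df -> is_diff x g df.
Proof.
move=> fg dfx; have fgx : f x = g x by exact: nbhs_singleton fg.
have go : g \o shift x = cst (g x) + 'd f x +o_ 0 id.
  have /eqaddoP fo := diff_locally (@ex_diff _ _ _ _ _ _ _ dfx).
  apply/eqaddoP => e e0; have := fo _ e0; rewrite -fgx.
  have : \forall v \near 0, f (v + x) = g (v + x).
    by move: fg; rewrite (near_shift 0 x) => /=; apply: filterS => v;
      rewrite /= subr0.
  by apply: filterS2 => v /= E; rewrite !fctE/= E.
have cf : continuous ('d f x) by apply: diff_continuous; exact: ex_diff.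
have dE := diff_unique cf go.
apply: DiffDef; last by rewrite dE; exact: diff_val.
by apply/diff_locallyP; rewrite dE.
Qed.

Lemma is_diff_coord n (V : normedModType R) (f df : V -> 'rV[R]_n) (x : V)
    (i : 'I_n) :
  is_diff x f df -> is_diff x (fun y => f y 0 i) (fun v => df v 0 i).
Proof.
move=> dfx.
have cl : linear (fun v : 'rV[R]_n => v 0 i) by move=> a u v; rewrite !mxE.
pose cM := GRing.isLinear.Build _ _ _ _ _ cl.
pose cL : {linear _ -> _} := HB.pack (fun v : 'rV[R]_n => v 0 i) cM.
have cc : continuous cL by move=> v; exact: coord_continuous.
have dc : is_diff (f x) cL cL.
  by apply: DiffDef; [exact: linear_differentiable|rewrite diff_lin].
exact: (@is_diff_comp _ _ _ _ f df cL cL x).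
Qed.

Lemma is_diff_row n (V : normedModType R) (f : V -> 'rV[R]_n)
    (df : 'I_n -> V -> R) (x : V) :
  (forall i, is_diff x (fun y => f y 0 i) (df i)) ->
  is_diff x f (fun v => \row_i df i v).
Proof.
move=> dfx.
have fE : f = \sum_i (fun y => f y 0 i *: delta_mx 0 i).
  by apply/funext => y; rewrite fct_sumE {1}(row_sum_delta (f y)).
have df0 : differentiable f x.
  rewrite fE; apply: differentiable_sum => i.
  by apply: differentiableZl; exact: ex_diff.
apply: DiffDef => //; apply/funext => v; apply/rowP => i; rewrite mxE.
rewrite -(@diff_val _ _ _ _ _ _ _ (dfx i)).
have := is_diff_coord i (differentiableP df0).
by move/(@diff_val _ _ _ _ _ _ _) => ->.
Qed.

(** Rows are indexed by the source variable, the transposed convention of the theorem; the chain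
    rule for [g \o T] thus has ['J T] on the left. *)
Lemma jacobianE n m (f df : 'rV[R]_n -> 'rV[R]_m) (x : 'rV[R]_n) i j :
  is_diff x f df -> ('J f x) i j = df (delta_mx 0 i) 0 j.
Proof.
by move=> dfx; rewrite /jacobian !mxE (@diff_val _ _ _ _ _ _ _ dfx).
Qed.

End row_differential.
Section analytic_differentiable.
Context {R : realType}.

Lemma ler_coord_norm n (v : 'rV[R]_n) i : `|v 0 i| <= `|v|.
Proof.
by rewrite [leRHS]/Num.Def.normr /= mx_normrE; exact: (le_bigmax _ _ (0, i)).
Qed.

(** The differential is the part [D] of total degree one. The bound on the partial sums is uniform
    in [N], hence survives the limit. *)
Lemma analytic_is_diff n (V : normedModType R) (f : 'rV[R]_n -> V) y :
  analytic_at f y -> differentiable f y.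
Proof.
move=> [c [r [r0 [M cM] fE]]].
pose e (i j : 'I_n) : nat := i == j.
pose D (v : 'rV[R]_n) : V := \sum_i v 0 i *: c (e i).
have Dl : linear D.
  move=> a u v; rewrite /D scaler_sumr -big_split/=; apply: eq_bigr => i _.
  by rewrite !mxE scalerDl scalerA.
pose DM := GRing.isLinear.Build _ _ _ _ _ Dl.
pose DL : {linear _ -> _} := HB.pack D DM.
have cD : continuous DL.
  move=> v; apply: (@differentiable_continuous _ _ _ v D).
  rewrite (_ : D = \sum_i (fun w : 'rV[R]_n => w 0 i *: c (e i))); last first.
    by apply/funext => w; rewrite fct_sumE.
  apply: differentiable_sum => i; apply: differentiableZl.
  exact: differentiable_coord.
pose F (v : 'rV[R]_n) N (alpha : {ffun 'I_n -> 'I_N}) : V :=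
  (\prod_i v 0 i ^+ alpha i) *: c (fun i => alpha i : nat).
pose S v N := \sum_(alpha : {ffun 'I_n -> 'I_N}) F v N alpha.
(* Only the terms of total degree at least 2 contribute to the difference, and
   each of them is at most (|v| / r)^2 times its value at |v| = r. *)
have SE v N : `|v| < r ->
    `|S v N.+2 - (c (fun=> 0%N) + D v)| <= M / r ^+ 2 * `|v| ^+ 2.
  move=> vr.
  have S0 : \sum_(alpha : {ffun 'I_n -> 'I_N.+2} | (\sum_i alpha i)%N == 0%N)
      F v _ alpha = c (fun=> 0%N).
    rewrite (big_pred1 [ffun=> ord0]) => [|alpha].
      rewrite /F big1 ?scale1r => [|i _]; last by rewrite ffunE expr0.
      by congr c; apply/funext => i; rewrite ffunE.
    rewrite /= sum_nat_eq0; apply/forallP/eqP => [H|-> i]; last by rewrite ffunE.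
    by apply/ffunP => i; apply/val_inj; rewrite ffunE; apply/eqP/(implyP (H i)).
  have S1 : \sum_(alpha : {ffun 'I_n -> 'I_N.+2} | (\sum_i alpha i)%N == 1%N)
      F v _ alpha = D v.
    (* The multi-indices of degree one inside the cube; [N.+2] leaves room for the exponent 1. *)
    pose h (i : 'I_n) : {ffun 'I_n -> 'I_N.+2} :=
      [ffun j => inord (e i j)].
    have hE i j : h i j = e i j :> nat.
      by rewrite ffunE inordK// /e; case: (_ == _).
    have hinj : injective h.
      move=> i j ij; apply/eqP; have := hE j i; rewrite -ij hE /e eqxx.
      by rewrite eq_sym; case: (_ == _).
    have sh i : (\sum_j h i j)%N = 1%N.
      rewrite (bigD1 i)//= hE /e eqxx big1// => j ji.
      by rewrite hE /e eq_sym (negbTE ji).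
    have hsurj (alpha : {ffun 'I_n -> 'I_N.+2}) : (\sum_i alpha i)%N = 1%N ->
        exists i, h i = alpha.
      move=> a1; have [i ai] : exists i, alpha i != 0%N :> nat.
        apply/existsP; rewrite -negb_forall; apply/negP => /forallP a0.
        by move: a1; rewrite big1// => i _; exact/eqP.
      exists i; apply/ffunP => j; apply/val_inj; rewrite /= hE /e.
      move: a1; rewrite (bigD1 i)//= => a1.
      have [ai1 a0] : alpha i = 1%N :> nat /\
          (\sum_(j < n | j != i) alpha j)%N = 0%N.
        by case: (nat_of_ord (alpha i)) ai a1 => // -[|//] _ [].
      have [<-|ij] := eqVneq i j; first by rewrite ai1.
      move/eqP: a0; rewrite sum_nat_eq0 => /forallP/(_ j).
      by rewrite eq_sym ij => /eqP ->.
    (* The partial inverse of [h], by which the terms of degree one are reindexed by coordinates. *)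
    pose g (alpha : {ffun 'I_n -> 'I_N.+2}) := [pick i | h i == alpha].
    have gh i : g (h i) = Some i.
      by rewrite /g; case: pickP => [j /eqP/hinj -> //|/(_ i)]; rewrite eqxx.
    rewrite (reindex_omap h g) => [|alpha /eqP/hsurj[i <-]]; last by rewrite gh.
    under eq_bigl do rewrite sh gh !eqxx.
    apply: eq_bigr => i _; rewrite /F; congr (_ *: c _); last first.
      by apply/funext => j; rewrite hE.
    rewrite (bigD1 i)//= hE /e eqxx expr1 big1 ?mulr1// => j ji.
    by rewrite hE /e eq_sym (negbTE ji) expr0.
  rewrite /S (bigID (fun alpha : {ffun 'I_n -> 'I_N.+2} =>
    (\sum_i alpha i)%N == 0%N))/= S0.
  rewrite [X in _ + X - _](bigID (fun alpha : {ffun 'I_n -> 'I_N.+2} =>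
    (\sum_i alpha i)%N == 1%N))/=.
  rewrite [X in _ + (X + _) - _](_ : _ = D v); last first.
    by rewrite -S1; apply: eq_bigl => alpha; case: eqP => // ->.
  rewrite addrA [X in `|X|]addrAC subrr add0r.
  apply: (le_trans (ler_norm_sum _ _ _)).
  apply: (@le_trans _ _ (\sum_(alpha : {ffun 'I_n -> 'I_N.+2})
     (`|c (fun i => alpha i : nat)| * r ^+ (\sum_i alpha i)%N) * (`|v| / r) ^+
       2)); last first.
    rewrite -mulr_suml expr_div_n [leRHS](_ : _ = M * (`|v| ^+ 2 / r ^+ 2));
      last by rewrite mulrAC -mulrA.
    by rewrite ler_wpM2r// divr_ge0// exprn_ge0// ltW.
  rewrite big_mkcond/=; apply: ler_sum => alpha _;
    case: ifPn => [/andP[a0 a1]|_]; last first.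
    by do ?[apply: exprn_ge0|apply: divr_ge0|apply: mulr_ge0] => //; exact: ltW.
  rewrite /F normrZ mulrC -mulrA ler_wpM2l//.
  have vr1 : `|v| / r <= 1 by rewrite ler_pdivrMr// mul1r ltW.
  apply: (@le_trans _ _ (`|v| ^+ (\sum_i alpha i)%N)).
    rewrite normr_prod expr_sum; apply: ler_prod => i _.
    by rewrite normrX exprn_ge0//= lerXn2r// ?nnegrE// ler_coord_norm.
  rewrite -[in leLHS](divfK (lt0r_neq0 r0) `|v|) exprMn mulrC ler_wpM2l
    ?exprn_ge0 ?(ltW r0)//.
  apply: ler_wiXn2l => //; first by rewrite divr_ge0// ltW.
  by case: (\sum_i _)%N a0 a1 => // -[].
have fB v : `|v| < r -> `|f (y + v) - (c (fun=> 0%N) + D v)| <= M / r ^+ 2 *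
  `|v| ^+ 2.
  move=> vr; have /(_ _) Sf := fE v vr.
  have : `|S v N - (c (fun=> 0%N) + D v)| @[N --> \oo] --> `|f (y + v) -
    (c (fun=> 0%N) + D v)|.
    by apply: cvg_norm; apply: cvgB; [exact: Sf|exact: cvg_cst].
  move/cvgr_to_le; apply; exists 2%N => // -[|[|N]]// _.
  exact: SE.
have D0 : D 0 = 0 by rewrite -[D]/(DL : _ -> _) linear0.
(* At [v = 0] the estimate has right-hand side 0. *)
have fy : f y = c (fun=> 0%N).
  have := fB 0; rewrite normr0 expr0n mulr0 addr0 D0 addr0 => /(_ r0).
  by rewrite normr_le0 subr_eq0 => /eqP.
suff : is_diff y f DL by move=> ?; exact: ex_diff.
apply: (is_diff_quadratic (C := M / r ^+ 2)) => //.
apply/nbhs_ballP; exists r => //= v; rewrite -ball_normE /ball_ /= sub0r normrN.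
by move=> /fB; rewrite fy [y + v]addrC.
Qed.

End analytic_differentiable.

(** * Integrals of exponential tilts *)

Section dot_lemmas.
Context {R : realType}.

Lemma dotDr n (x u v : 'rV[R]_n) : dot x (u + v) = dot x u + dot x v.
Proof. by rewrite /dot -big_split/=; apply: eq_bigr => i _; rewrite mxE mulrDr. Qed.

Lemma dotZr n a (x u : 'rV[R]_n) : dot x (a *: u) = a * dot x u.
Proof. by rewrite /dot mulr_sumr; apply: eq_bigr => i _; rewrite mxE mulrCA. Qed.

Lemma dot_delta n (x : 'rV[R]_n) i : dot x (delta_mx 0 i) = x 0 i.
Proof.
rewrite /dot (bigD1 i)//= !mxE !eqxx mulr1 big1 ?addr0// => j ji.
by rewrite !mxE (negbTE ji) mulr0.
Qed.

Lemma ler_dot n (x v : 'rV[R]_n) : `|dot x v| <= n%:R * (`|x| * `|v|).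
Proof.
apply: (le_trans (ler_norm_sum _ _ _)).
apply: (@le_trans _ _ (\sum_(i < n) `|x| * `|v|)).
  by apply: ler_sum => i _; rewrite normrM ler_pM// ler_coord_norm.
by rewrite sumr_const card_ord mulr_natl.
Qed.

(** Follows from the tangent inequality [1 + a <= expR a], used at [a] and at [- a]. *)
Lemma expR_taylor1_le (a : R) : `|expR a - 1 - a| <= a ^+ 2 * expR `|a|.
Proof.
have h1 : 0 <= expR a - 1 - a by rewrite -addrA -opprD subr_ge0 expR_ge1Dx.
rewrite ger0_norm//.
have h2 : expR a - 1 <= a * expR a.
  have := expR_ge1Dx (- a); rewrite expRN => h.
  have := ler_wpM2r (expR_ge0 a) h; rewrite mulVf ?gt_eqF ?expR_gt0//.
  by rewrite mulrDl mul1r; lra.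
have [a0|a0] := leP 0 a.
  rewrite (ger0_norm a0) expr2 -mulrA; have := ler_wpM2l a0 h2.
  by rewrite mulrBr; lra.
have e1 : expR a <= 1 by rewrite -expR0 ler_expR ltW.
have e2 : 1 <= expR (- a) by rewrite -expR0 ler_expR; lra.
rewrite (ltr0_norm a0).
(* For [a < 0] the remainder is at most [- a * (1 - expR a)], and [1 - expR a <= - a]. *)
apply: (@le_trans _ _ (a ^+ 2)); last by rewrite ler_peMr// sqr_ge0.
have := expR_ge1Dx a; rewrite expr2 => h3.
have : - a * (1 - expR a) <= - a * - a by apply: ler_wpM2l; lra.
by rewrite mulrNN mulNr mulrBr; lra.
Qed.

Lemma ler_expR_scale (e x : R) : 0 < e -> x <= e^-1 * expR (e * x).
Proof.
move=> e0; rewrite -ler_pdivrMl ?invr_gt0// invrK.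
by apply: le_trans (expR_ge1Dx _); rewrite lerDr.
Qed.

Lemma ler_quarter2 (x : R) : 0 <= x -> x / 4 + x / 4 <= x.
Proof. lra. Qed.

End dot_lemmas.

Lemma Rintegral_sum {R : realType} d (T : measurableType d)
    (mu : {measure set T -> \bar R}) (D : set T) (I : Type) (s : seq I)
    (f : I -> T -> R) :
  measurable D -> (forall i, mu.-integrable D (EFin \o f i)) ->
  (\int[mu]_(x in D) (\sum_(i <- s) f i x) =
   \sum_(i <- s) \int[mu]_(x in D) f i x)%R.
Proof.
move=> mD fi; rewrite sum_fine => [|i _];
  last by apply: integrable_fin_num => //; exact: fi.
rewrite -integral_sum// /Rintegral; congr fine.
by apply: eq_integral => x _; rewrite sumEFin.
Qed.

Section tilted_integral.
Context {R : realType} {disp : measure_display} {Omega : measurableType disp}.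
Variables (mu : {measure set Omega -> \bar R}) (n : nat).
Variables (X : Omega -> 'rV[R]_n) (K : Omega -> R).
Hypothesis mX : forall i, measurable_fun setT (fun w => X w 0 i).
Hypothesis mK : measurable_fun setT K.
Hypothesis K0 : forall w, 0 <= K w.

Lemma measurable_dot (t : 'rV[R]_n) : measurable_fun setT (fun w => dot (X w) t).
Proof.
rewrite /dot; apply: measurable_sum => i; apply: measurable_funM => //.
Qed.

(** With [K = expR (- phi X)] and [u = cst 1] this is the function G of the overview; the
    coordinates of [X] as [u] give its gradient. *)
Definition tilted (t : 'rV[R]_n) (u : Omega -> R) : R :=
  (\int[mu]_w (u w * (K w * expR (dot (X w) t))))%R.

Variables (t0 : 'rV[R]_n) (delta : R).
Hypothesis delta0 : 0 < delta.
Let Q w := K w * expR (dot (X w) t0).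
Hypothesis exp_moment :
  mu.-integrable setT (fun w => (Q w * expR (delta * `|X w|))%:E).

Let mQ : measurable_fun setT Q.
Proof.
apply: measurable_funM => //; apply: measurableT_comp => //.
exact: measurable_dot.
Qed.

Let Q0 w : 0 <= Q w. Proof. by rewrite mulr_ge0// expR_ge0. Qed.

Lemma tilted_integrable (g : Omega -> R) C : measurable_fun setT g ->
  (forall w, `|g w| <= C * expR (delta * `|X w|)) ->
  mu.-integrable setT (fun w => (g w * (K w * expR (dot (X w) t0)))%:E).
Proof.
move=> mg gC; apply: (le_integrable _ _ _
  (integrableZl measurableT C exp_moment)) => //.
  by apply/measurable_EFinP; apply: measurable_funM.
move=> w _; rewrite -EFinM /= lee_fin -/(Q w) normrM (ger0_norm (Q0 w)).
rewrite (le_trans _ (ler_norm _))// [leRHS]mulrCA mulrC ler_wpM2l//.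
Qed.

(** Differentiation under the integral by a Taylor bound. The moment of order [delta] is split into
    quarters: one bounds [u], two absorb [|X|^2], and one absorbs the exponential in the Taylor
    remainder. *)
Lemma tilted_is_diff (u : Omega -> R) C : measurable_fun setT u ->
  (forall w, `|u w| <= C * expR (delta / 4 * `|X w|)) ->
  is_diff t0 (tilted ^~ u)
    (fun s => \sum_k s 0 k * tilted t0 (fun w => u w * X w 0 k)).
Proof.
move=> mu_ uC.
have d4 : 0 < delta / 4 by rewrite divr_gt0.
have uC' w : `|u w| <= C * expR (delta * `|X w|).
  apply: (le_trans (uC w)); rewrite ler_wpM2l//; last first.
    by rewrite ler_expR ler_wpM2r// ler_pdivrMr// ler_pMr// ler1n.
  have := le_trans (normr_ge0 _) (uC w).
  by rewrite pmulr_lge0 ?expR_gt0.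
(* The sign of [C] is read off from the bound at a point, hence the argument [w]. *)
have C0 (w : Omega) : 0 <= C.
  by have := le_trans (normr_ge0 _) (uC w); rewrite pmulr_lge0 ?expR_gt0.
pose c : R := (delta / 4)^-1.
have c0 : 0 < c by rewrite invr_gt0.
have iu := tilted_integrable mu_ uC'.
have Xe w : `|X w| <= c * expR (delta / 4 * `|X w|) by exact: ler_expR_scale.
have iuX k : mu.-integrable setT
    (fun w => ((u w * X w 0 k) * (K w * expR (dot (X w) t0)))%:E).
  apply: (@tilted_integrable _ (C * c)) => [|w].
    exact: measurable_funM.
  rewrite normrM.
  apply: (@le_trans _ _ ((C * expR (delta / 4 * `|X w|)) *
    (c * expR (delta / 4 * `|X w|)))).
    by apply: ler_pM => //; apply: le_trans (Xe w); exact: ler_coord_norm.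
  rewrite mulrACA -expRD ler_wpM2l//; first by rewrite mulr_ge0 ?(C0 w) ?ltW.
  by rewrite ler_expR -mulrDl ler_wpM2r// ler_quarter2// ltW.
have Ll : linear (fun s : 'rV[R]_n => \sum_k s 0 k * tilted t0
  (fun w => u w * X w 0 k)).
  move=> a x y; rewrite /= scaler_sumr -big_split/=; apply: eq_bigr => i _.
  by rewrite !mxE mulrDl -mulrA.
pose LM := GRing.isLinear.Build _ _ _ _ _ Ll.
pose L : {linear 'rV[R]_n -> R} := HB.pack
  (fun s : 'rV[R]_n => \sum_k s 0 k * tilted t0 (fun w => u w * X w 0 k)) LM.
pose q (w : Omega) := Q w * expR (delta * `|X w|).
have cL : continuous L.
  move=> s; apply: (@differentiable_continuous _ _ _ s L).
  rewrite (_ : (L : _ -> _) = \sum_k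
    (fun s : 'rV[R]_n => s 0 k *: (tilted t0 (fun w => u w * X w 0 k) : R^o)));
      last first.
    by apply/funext => v; rewrite fct_sumE.
  apply: differentiable_sum => i; apply: differentiableZl.
  exact: differentiable_coord.
suff : is_diff t0 (tilted ^~ u) L by [].
apply: (is_diff_quadratic (L := L) (C := C * (n%:R * c) ^+ 2 * \int[mu]_w q
  w)) => //.
(* For such [v] the form [dot (X w) v] stays below [delta / 4 * |X w|]; the denominator is [n + 1]
   since [n] may be 0. *)
have : \forall v \near (0 : 'rV[R]_n), `|v| <= delta / 4 / (n%:R + 1).
  by apply: nbhs0_le; rewrite divr_gt0// ltr_wpDl.
apply: filterS => v vn.
have nv : n%:R * `|v| <= delta / 4.
  apply: (@le_trans _ _ ((n%:R + 1) * `|v|)); first by rewrite ler_wpM2r// lerDl.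
  by rewrite mulrC -ler_pdivlMr// ltr_wpDl.
have av (w : Omega) : `|dot (X w) v| <= delta / 4 * `|X w|.
  apply: (le_trans (ler_dot _ _)); rewrite mulrCA mulrC.
  by rewrite ler_wpM2r// mulrC.
have LvE : L v = \int[mu]_w ((u w * dot (X w) v) * Q w).
  pose g k w := v 0 k * ((u w * X w 0 k) * Q w).
  transitivity (\sum_k \int[mu]_w g k w).
    by apply: eq_bigr => k _; rewrite RintegralZl//; exact: iuX.
  rewrite -Rintegral_sum// => [|k]; last first.
    have := integrableZl measurableT (v 0 k) (iuX k).
    by apply: eq_integrable => // w _; rewrite -EFinM.
  apply: eq_Rintegral => w _; rewrite /dot mulr_sumr mulr_suml.
  by apply: eq_bigr => k _; rewrite /g; ring.
have mdv : measurable_fun setT (fun w => dot (X w) v) by exact: measurable_dot.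
have iud : mu.-integrable setT (fun w => ((u w * dot (X w) v) * Q w)%:E).
  apply: (@tilted_integrable _ (C * 1)) => [|w].
    exact: measurable_funM.
  rewrite normrM.
  apply: (@le_trans _ _ ((C * expR (delta / 4 * `|X w|)) *
    (1 * expR (delta / 4 * `|X w|)))).
    apply: ler_pM => //; rewrite mul1r; apply: (le_trans (av w)).
    by apply: le_trans (expR_ge1Dx _); rewrite lerDr.
  rewrite mulrACA -expRD ler_wpM2l//; first by rewrite mulr1 (C0 w).
  by rewrite ler_expR -mulrDl ler_wpM2r// ler_quarter2// ltW.
have iuv : mu.-integrable setT (fun w => ((u w * expR (dot (X w) v)) * Q w)%:E).
  apply: (@tilted_integrable _ C) => [|w].
    apply: measurable_funM => //; exact: measurableT_comp.
  rewrite normrM (ger0_norm (expR_ge0 _)).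
  apply: (@le_trans _ _ ((C * expR (delta / 4 * `|X w|)) * expR
    (delta / 4 * `|X w|))).
    apply: ler_pM; [by []|exact: expR_ge0|exact: uC|].
    by rewrite ler_expR (le_trans (ler_norm _)).
  rewrite -mulrA -expRD ler_wpM2l//; first by rewrite (C0 w).
  by rewrite ler_expR -mulrDl ler_wpM2r// ler_quarter2// ltW.
have -> : tilted (v + t0) u = \int[mu]_w ((u w * expR (dot (X w) v)) * Q w).
  by apply: eq_Rintegral => w _; rewrite dotDr expRD /Q; ring.
rewrite LvE {1}/tilted -RintegralD// -RintegralB//; last first.
  by have := integrableD measurableT iu iud; apply: eq_integrable.
(* The quantity to be bounded is the integral of [u] times the Taylor remainder of the
   exponential. *)
have iD : mu.-integrable setT (fun w =>
  (u w * (expR (dot (X w) v) - 1 - dot (X w) v) * Q w)%:E).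
  have := integrableB measurableT iuv (integrableD measurableT iu iud).
  apply: eq_integrable => // w _; apply: (congr1 EFin).
  by rewrite -/(Q w); ring.
rewrite (@eq_Rintegral _ _ _ mu setT
  (fun w => u w * (expR (dot (X w) v) - 1 - dot (X w) v) * Q w) _); last first.
  by move=> w _; rewrite -/(Q w); ring.
apply: (le_trans (le_normr_Rintegral measurableT iD)).
rewrite mulrAC -RintegralZl//.
apply: le_Rintegral => //.
- exact: (integrable_norm iD).
- have := integrableZl measurableT (C * (n%:R * c) ^+ 2 * `|v| ^+ 2) exp_moment.
  by apply: eq_integrable => // w _; rewrite -EFinM.
move=> w _; rewrite normrM (ger0_norm (Q0 w)) /q mulrA mulrAC ler_wpM2r//.
rewrite normrM.
have a2 : `|expR (dot (X w) v) - 1 - dot (X w) v| <=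
    (n%:R * c * `|v|) ^+ 2 * (expR (delta / 4 * `|X w|) ^+ 2 * expR
      (delta / 4 * `|X w|)).
  apply: (le_trans (expR_taylor1_le _)); rewrite mulrA; apply: ler_pM.
  - by rewrite sqr_ge0.
  - exact: expR_ge0.
  - rewrite -exprMn -[leLHS]real_normK ?num_real// lerXn2r ?nnegrE//.
      by rewrite !mulr_ge0// ?expR_ge0// ltW.
    apply: (le_trans (ler_dot _ _)).
    rewrite [leRHS](_ : _ = n%:R * ((c * expR (delta / 4 * `|X w|)) * `|v|));
      last by ring.
    by rewrite ler_wpM2l// ler_wpM2r.
  - by rewrite ler_expR.
apply: le_trans (ler_pM (normr_ge0 _) (normr_ge0 _) (uC w) a2) _.
(* The four quarters recombine into the exponential moment in [q]. *)
rewrite [leLHS](_ : _ = C * (n%:R * c) ^+ 2 * `|v| ^+ 2 * expR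
  (delta / 4 * `|X w|) ^+ 4); last by ring.
rewrite ler_wpM2l//; first by do ?[exact: sqr_ge0|exact: (C0 w)|apply: mulr_ge0].
by rewrite -expRM_natl ler_expR mulrA [4 * _]mulrC divfK.
Qed.

End tilted_integral.

(** * Exponential moments and the Jacobian of a tilted mean *)

Lemma cross_polytope_expR {R : realType} n (T : 'rV[R]_n -> 'rV[R]_n)
    (y : 'rV[R]_n) (U : set 'rV[R]_n) :
  differentiable T y -> 'J T y \in unitmx -> nbhs y U ->
  exists (eta : R) (p : 'I_n * bool -> 'rV[R]_n), [/\ 0 < eta,
    forall j, U (p j) &
    forall x, expR (eta * `|x|) <= 1 + \sum_j expR (dot x (T (p j) - T y))].
Proof.
move=> dT JT Uy.
pose A := invmx ('J T y).
pose a (i : 'I_n) : 'rV[R]_n := delta_mx 0 i *m A.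
have dTa i : 'd T y (a i) = delta_mx 0 i :> 'rV[R]_n.
  by rewrite -(mul_rV_lin1 ('d T y)) -/(jacobian T y) mulmxKV.
pose N := 1 + \sum_i `|a i|.
have N1 : 1 <= N by rewrite lerDl sumr_ge0.
have N0 : 0 < N by exact: lt_le_trans N1.
have aN i : `|a i| <= N.
  rewrite /N (bigD1 i)//= addrCA lerDl addr_ge0// sumr_ge0//.
(* With this precision the error at a vertex is at most [e / (2 * (n + 1))]; paired with [x] it is
   multiplied by at most [n * |x|], so it costs at most half of the main term [e * |x|]. *)
pose k : R := (2 * (n%:R + 1) * N)^-1.
have k0 : 0 < k by rewrite invr_gt0 !mulr_gt0// ltr_wpDl.
have /eqaddoP/(_ _ k0) near1 := diff_locally dT.
have near2 : \forall v \near (0 : 'rV[R]_n), U (v + y).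
  have : \forall z \near y, U z by [].
  by rewrite (near_shift 0 y); apply: filterS => v; rewrite /= subr0.
have /nbhs_ballP[r /= r0 rP] : \forall v \near (0 : 'rV[R]_n),
    `|T (v + y) - (T y + 'd T y v)| <= k * `|v| /\ U (v + y).
  by near=> v; split; [near: v; exact: near1|near: v; exact: near2].
(* The displacements then have norm at most [e * N = r / 2], inside the ball of radius [r]. *)
pose e := r / (2 * N).
have e0 : 0 < e by rewrite divr_gt0// mulr_gt0.
pose s (b : bool) : R := if b then e else - e.
have sb b : `|s b| = e by rewrite /s; case: b; rewrite ?normrN gtr0_norm.
pose p (j : 'I_n * bool) := s j.2 *: a j.1 + y.
have pP j : `|T (p j) - (T y + s j.2 *: delta_mx 0 j.1)| <= e /
  (2 * (n%:R + 1)) /\ U (p j).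
  have na : `|s j.2 *: a j.1| <= e * N by rewrite normrZ sb ler_wpM2l// ltW.
  have [|H HU] := rP (s j.2 *: a j.1).
    rewrite -ball_normE /ball_ /= sub0r normrN (le_lt_trans na)//.
    rewrite /e mulrAC ltr_pdivrMr ?mulr_gt0// [ltRHS]mulrA.
    rewrite ltr_pM2r// ltr_pMr// ltr1n//.
  split => //; move: H; rewrite linearZ/= dTa => /le_trans; apply.
  rewrite (le_trans (ler_wpM2l (ltW k0) na))//.
  by rewrite /k le_eqVlt; apply/orP; left; apply/eqP; field;
    rewrite !gt_eqF// ltr_wpDl.
exists (e / 2), p; split; [by rewrite divr_gt0|by move=> j; case: (pP j)|].
move=> x.
(* The summand 1 covers this case, in particular [n = 0], where there are no vertices. *)
have [->|x0] := eqVneq x 0.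
  by rewrite normr0 mulr0 expR0 lerDl sumr_ge0// => j _; exact: expR_ge0.
(* The vertex that suits [x] lies on the axis where the sup norm of [x] is attained, on the side
   given by the sign of that coordinate. *)
have /mx_norm_neq0[[i0 i] /= xi] : mx_norm x != 0.
  by rewrite -[mx_norm x]/`|x| normr_eq0.
rewrite ord1 in xi; have {}xi : `|x| = `|x 0 i| by [].
pose b := 0 <= x 0 i.
have sxi : s b * x 0 i = e * `|x|.
  by rewrite xi /s /b; case: ifPn => [/ger0_norm ->//|];
    rewrite -ltNge => /ltr0_norm ->; rewrite mulNr mulrN.
have /= [H _] := pP (i, b).
have ineq : e / 2 * `|x| <= dot x (T (p (i, b)) - T y).
  rewrite (_ : T (p (i, b)) - T y = s b *: delta_mx 0 i +
    (T (p (i, b)) - (T y + s b *: delta_mx 0 i))); last first.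
    by rewrite [RHS]addrC opprD addrA subrK.
  rewrite dotDr dotZr dot_delta sxi.
  have := ler_dot x (T (p (i, b)) - (T y + s b *: delta_mx 0 i)).
  rewrite ler_norml => /andP[+ _].
  have : n%:R * (`|x| * `|T (p (i, b)) - (T y + s b *: delta_mx 0 i)|) <= e / 2
    * `|x|.
    apply: (@le_trans _ _ (n%:R * (`|x| * (e / (2 * (n%:R + 1)))))).
      by rewrite ler_wpM2l// ler_wpM2l.
    rewrite [leLHS](_ : _ = e / 2 * `|x| * (n%:R / (n%:R + 1))); last first.
      by field; rewrite gt_eqF// ltr_wpDl.
    apply: ler_piMr; first by rewrite mulr_ge0// divr_ge0// ltW.
    by rewrite ler_pdivrMr ?ltr_wpDl// mul1r lerDl.
  set u := n%:R * _; set z := dot x _; move=> h1 h2; lra.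
rewrite (bigD1 (i, b))//= addrCA (le_trans
  (y := expR (dot x (T (p (i, b)) - T y))))//.
  by rewrite ler_expR.
by rewrite lerDl addr_ge0// sumr_ge0// => j _; exact: expR_ge0.
Unshelve. all: by end_near. Qed.

Lemma measurable_row_norm {R : realType} d (Omega : measurableType d) n
    (X : Omega -> 'rV[R]_n) :
  (forall i, measurable_fun setT (fun w => X w 0 i)) ->
  measurable_fun setT (fun w => `|X w|).
Proof.
move=> mX; rewrite (_ : (fun w => _) =
  (fun w => \big[Num.max/0]_ij `|X w ij.1 ij.2|)); last first.
  by apply/funext => w; rewrite -mx_normrE.
elim: (index_enum _) => [|[i j] s IH].
  by under eq_fun do rewrite big_nil; exact: measurable_cst.
under eq_fun do rewrite big_cons.
apply: measurable_maxr => //=; rewrite ord1; exact: measurableT_comp.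
Qed.

Section tilted_mean.
Context {R : realType} {disp : measure_display} {Omega : measurableType disp}.
Variables (mu : {measure set Omega -> \bar R}) (n : nat).
Variables (X : Omega -> 'rV[R]_n) (K : Omega -> R).
Hypothesis mX : forall i, measurable_fun setT (fun w => X w 0 i).
Hypothesis mK : measurable_fun setT K.
Hypothesis K0 : forall w, 0 <= K w.

Lemma exp_moment_near (T : 'rV[R]_n -> 'rV[R]_n) y :
  differentiable T y -> 'J T y \in unitmx ->
  (\forall z \near y,
    mu.-integrable setT (fun w => (K w * expR (dot (X w) (T z)))%:E)) ->
  exists2 eta : R, 0 < eta & mu.-integrable setT
    (fun w => (K w * expR (dot (X w) (T y)) * expR (eta * `|X w|))%:E).
Proof.
(* The neighborhood given to the cross-polytope is the set of [z] with integrable tilt, so the tilt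
   at each vertex is integrable. *)
move=> dT JT iK; have [eta [p [eta0 iKp le_p]]] := cross_polytope_expR dT JT iK.
exists eta => //.
have iS := integrable_sum measurableT (index_enum _) (P := xpredT)
  (fun j _ => iKp j).
have iy := nbhs_singleton iK.
apply: le_integrable (integrableD measurableT iy iS) => //.
  apply/measurable_EFinP; apply: measurable_funM.
    apply: measurable_funM => //; apply: measurableT_comp => //.
    exact: measurable_dot.
  apply: measurableT_comp => //; apply: measurable_funM => //.
  exact: measurable_row_norm.
move=> w _; rewrite sumEFin -EFinD /= lee_fin ger0_norm; last first.
  by rewrite !mulr_ge0 ?expR_ge0.
apply: le_trans (ler_norm _); rewrite -mulrA -mulr_sumr -mulrDr ler_wpM2l//.
apply: le_trans (ler_wpM2l (expR_ge0 _) (le_p (X w))) _.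
rewrite mulrDr mulr1 lerD2l mulr_sumr ler_sum// => j _.
by rewrite -expRD -dotDr addrC subrK.
Qed.

(** The quotient rule for first moments: with [g] the mean as a function of the tilt parameter,
    [m = g \o T] near [y], and the derivative of [g] is the covariance. *)
Lemma tilted_mean_jacobian (T m : 'rV[R]_n -> 'rV[R]_n) y :
  differentiable T y -> 'J T y \in unitmx ->
  (\forall z \near y,
    mu.-integrable setT (fun w => (K w * expR (dot (X w) (T z)))%:E)) ->
  tilted mu X K (T y) (cst 1) != 0 ->
  (\forall z \near y, m z = \row_i
    (tilted mu X K (T z) (fun w => X w 0 i) / tilted mu X K (T z) (cst 1))) ->
  differentiable m y /\
  invmx ('J T y) *m 'J m y = \matrix_(k, i)
    (tilted mu X K (T y) (fun w => (X w 0 k - m y 0 k) * (X w 0 i - m y 0 i))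
     / tilted mu X K (T y) (cst 1)).
Proof.
move=> dT JT iK N0 mE.
have [delta delta0 em] := exp_moment_near dT JT iK.
have em_le (w : Omega) e : 0 <= e -> 1 <= expR (e * `|X w|).
  by move=> e0; rewrite -expR0 ler_expR mulr_ge0.
pose N u := tilted mu X K (T y) u.
pose c : R := (delta / 4)^-1.
have d4 : 0 < delta / 4 by rewrite divr_gt0.
have c0 : 0 < c by rewrite invr_gt0.
have Xle (w : Omega) i : `|X w 0 i| <= c * expR (delta / 4 * `|X w|).
  by apply: (le_trans (ler_coord_norm _ _)); exact: ler_expR_scale.
have d1 := tilted_is_diff mX mK K0 delta0 em (u := cst 1) (C := 1)
  (measurable_cst _) (fun w => _).
have {}d1 : is_diff (T y) (tilted mu X K ^~ (cst 1))
    (fun s => \sum_k s 0 k * N (fun w => X w 0 k)).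
  apply: is_diff_eq; first by apply: d1 => w; rewrite normr1 mul1r em_le// ltW.
  apply/funext => s; apply: eq_bigr => k _; congr (_ * tilted _ _ _ _ _).
  by apply/funext => w; rewrite /cst mul1r.
have dX i : is_diff (T y) (tilted mu X K ^~ (fun w => X w 0 i))
    (fun s => \sum_k s 0 k * N (fun w => X w 0 i * X w 0 k)).
  exact: (tilted_is_diff mX mK K0 delta0 em (mX i) (fun w => Xle w i)).
have iP (u : Omega -> R) C : measurable_fun setT u ->
  (forall w, `|u w| <= C * expR (delta * `|X w|)) ->
   mu.-integrable setT (fun w => (u w * (K w * expR (dot (X w) (T y))))%:E).
  exact: (tilted_integrable mX mK K0 em).
pose g i := tilted mu X K ^~ (fun w => X w 0 i) *
  (fun t => (tilted mu X K t (cst 1))^-1).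
pose cov i k := N (fun w => X w 0 i * X w 0 k) / N (cst 1)
  - N (fun w => X w 0 i) / N (cst 1) * (N (fun w => X w 0 k) / N (cst 1)).
have dg i : is_diff (T y) (g i) (fun s => \sum_k s 0 k * cov i k).
  have dV : is_diff (T y) (fun t => (tilted mu X K t (cst 1))^-1)
     (- (N (cst 1)) ^- 2 *: (fun s : 'rV[R]_n => \sum_k s 0 k * N
       (fun w => X w 0 k))).
    apply: DiffDef; first exact: (differentiableV (ex_diff (is_diff_def := d1))).
    by rewrite (diffV (ex_diff (is_diff_def := d1)))//;
      rewrite (diff_val (is_diff_def := d1)).
  apply: (is_diff_eq (is_diffM (dX i) dV)).
  apply/funext => s; transitivity (N (fun w => X w 0 i) *
      (- (N (cst 1)) ^- 2 * \sum_k s 0 k * N (fun w => X w 0 k)) +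
      (N (cst 1))^-1 * \sum_k s 0 k * N (fun w => X w 0 i * X w 0 k)) => //.
  rewrite !mulr_sumr -big_split/=; apply: eq_bigr => k _.
  by rewrite /cov; field.
have dm : is_diff y m (fun v => \row_i \sum_k ('d T y v) 0 k * cov i k).
  apply: near_eq_is_diff (is_diff_row (f := fun z => \row_i (g i (T z))) _).
    by move: mE; apply: filterS => z ->; apply/rowP => i; rewrite !mxE.
  move=> i; rewrite (_ : (fun z => _) = g i \o T); last first.
    by apply/funext => z; rewrite mxE.
  exact: (is_diff_comp (differentiableP dT) (dg i)).
split; first exact: ex_diff.
have -> : 'J m y = 'J T y *m (\matrix_(k, i) cov i k).
  apply/matrixP => i j; rewrite (jacobianE _ _ dm) !mxE; apply: eq_bigr => k _.
  by rewrite (jacobianE _ _ (differentiableP dT)) !mxE.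
rewrite mulKmx//; apply/matrixP => k i; rewrite !mxE.
rewrite (nbhs_singleton mE) !mxE -!/(N _).
set mk := N (fun w => X w 0 k) / N (cst 1);
  set mi := N (fun w => X w 0 i) / N (cst 1).
have ile (u : Omega -> R) : (forall w, `|u w| <= c * expR (delta / 4 * `|X w|)) ->
    forall w, `|u w| <= c * expR (delta * `|X w|).
  move=> uc w; rewrite (le_trans (uc w))// ler_wpM2l ?(ltW c0)//.
  by rewrite ler_expR ler_wpM2r// ler_pdivrMr// ler_pMr// ler1n.
have i1 : mu.-integrable setT (fun w => (1 * (K w * expR (dot (X w) (T y))))%:E).
  by apply: (iP (cst 1) 1) => // w; rewrite normr1 mul1r em_le// ltW.
have iX j : mu.-integrable setT (fun w =>
  (X w 0 j * (K w * expR (dot (X w) (T y))))%:E).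
  by apply: (iP _ c) => //; apply: ile => w.
have iXX : mu.-integrable setT (fun w =>
  (X w 0 i * X w 0 k * (K w * expR (dot (X w) (T y))))%:E).
  apply: (iP _ (c * c)) => [|w]; first exact: measurable_funM.
  rewrite normrM; apply: (le_trans (ler_pM (normr_ge0 _) (normr_ge0 _)
    (Xle w i) (Xle w k))).
  rewrite mulrACA -expRD ler_wpM2l//; first by rewrite mulr_ge0 ?ltW.
  by rewrite ler_expR -mulrDl ler_wpM2r// ler_quarter2// ltW.
(* Expanding the centered product takes four integrals that are finite separately, by the
   exponential moment. *)
have -> : N (fun w => (X w 0 k - mk) * (X w 0 i - mi)) =
  N (fun w => X w 0 i * X w 0 k) - (mk * N (fun w => X w 0 i) + mi * N
    (fun w => X w 0 k))
   + mk * mi * N (cst 1).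
  have iZ r (u : Omega -> R) : mu.-integrable setT (fun w => (u w)%:E) ->
      mu.-integrable setT (fun w => (r * u w)%:E).
    by move=> /(integrableZl measurableT r); apply: eq_integrable.
  rewrite /N /tilted -!RintegralZl//; [|exact: iX|exact: iX].
  rewrite -RintegralD//; [|exact: iZ|exact: iZ].
  rewrite -RintegralB//; last first.
    by have := integrableD measurableT (iZ mk _ (iX i)) (iZ mi _ (iX k));
      apply: eq_integrable.
  have iB := integrableB measurableT iXX
    (integrableD measurableT (iZ mk _ (iX i)) (iZ mi _ (iX k))).
  rewrite -RintegralD//; last exact: iZ.
  by apply: eq_Rintegral => w _ /=; ring.
have covE (a b c' e : R) : e != 0 -> a / e - b / e * (c' / e) =
    (a - (c' / e * b + b / e * c') + c' / e * (b / e) * e) / e.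
  by move=> ?; field.
exact: covE.
Qed.

End tilted_mean.

(** * Joint laws with a conditional density *)

Section density_measure.
Context d (T : measurableType d) (R : realType).
Variables (m : {measure set T -> \bar R}) (k : T -> R).
Hypothesis mk : measurable_fun setT k.
Hypothesis k0 : forall x, 0 <= k x.
Local Open Scope ereal_scope.

Lemma density_measure_exists : exists nu : {measure set T -> \bar R},
  forall A, nu A = \int[m]_(x in A) (k x)%:E.
Proof.
pose nu A := \int[m]_(x in A) (k x)%:E.
have nu0 : nu set0 = 0 by rewrite /nu integral_set0.
have nu_ge0 A : 0 <= nu A by apply: integral_ge0 => x _; rewrite lee_fin.
have nuS : semi_sigma_additive nu.
  move=> F mF tF mUF; rewrite /nu ge0_integral_bigcup//.
  - by apply: is_cvg_nneseries => n _ _; exact: nu_ge0.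
  - by apply: measurable_funTS; exact/measurable_EFinP.
  - by move=> x _; rewrite lee_fin.
pose nuM := isMeasure.Build _ _ _ nu nu0 nu_ge0 nuS.
pose nu' : {measure set T -> \bar R} := HB.pack nu nuM.
by exists nu'.
Qed.

Import HBNNSimple.

(** [F] may have an infinite integral and [nu] need not be sigma-finite, so the proof climbs from
    indicators by monotone convergence. *)
Lemma ge0_integral_density (nu : {measure set T -> \bar R}) (F : T -> \bar R) :
  (forall A, measurable A -> nu A = \int[m]_(x in A) (k x)%:E) ->
  measurable_fun setT F -> (forall x, 0 <= F x) ->
  \int[nu]_x F x = \int[m]_x (F x * (k x)%:E).
Proof.
move=> nuE mF F0.
have mkE : measurable_fun setT (fun x => (k x)%:E) by exact/measurable_EFinP.
have simple (g : {nnsfun T >-> R}) :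
    \int[nu]_x (g x)%:E = \int[m]_x ((g x)%:E * (k x)%:E).
  under eq_integral do rewrite fimfunE -fsumEFin//.
  rewrite ge0_integral_fsum//; last 2 first.
  - by move=> r; exact/measurable_EFinP/measurableT_comp.
  - by move=> n x _; rewrite EFinM nnfun_muleindic_ge0.
  under [RHS]eq_integral => x _.
    rewrite muleC fimfunE -fsumEFin// ge0_mule_fsumr; last first.
      by move=> r; rewrite EFinM nnfun_muleindic_ge0.
    over.
  rewrite [RHS]ge0_integral_fsum//; last 2 first.
  - move=> r; apply: emeasurable_funM => //.
    exact/measurable_EFinP/measurableT_comp.
  - move=> n x _; rewrite mule_ge0 ?lee_fin//.
    by rewrite -lee_fin EFinM nnfun_muleindic_ge0.
  apply: eq_fsbigr => r; rewrite inE => -[x _ grx].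
  have r0 : (0 <= r)%R by rewrite -grx.
  have mA : measurable (g @^-1` [set r]) by [].
  rewrite integralZl_indic_nnsfun//= integral_indic// setIT nuE//.
  rewrite integral_mkcond -ge0_integralZl//.
  - by apply: eq_integral => z _; rewrite /= patchE indicE; case: ifPn => zA;
      rewrite ?mulr1 ?mulr0 ?mule0// muleC.
  - by apply/measurable_restrict => //; rewrite setTI; exact: measurable_funTS.
  - by move=> z _; rewrite patchE; case: ifPn; rewrite ?lee_fin.
pose g := nnsfun_approx measurableT mF.
have gF x : (g n x)%:E @[n --> \oo] --> F x by exact: cvg_nnsfun_approx.
have gnd x a b : (a <= b)%N -> (g a x <= g b x)%R.
  by move=> ab; exact/lefP/nd_nnsfun_approx.
transitivity (limn (fun n => \int[nu]_x (g n x)%:E)).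
  rewrite -monotone_convergence//.
  - by apply: eq_integral => x _; apply/esym/cvg_lim.
  - by move=> n; exact/measurable_EFinP.
  - by move=> n x _; rewrite lee_fin.
  - by move=> x _ a b ab; rewrite lee_fin gnd.
rewrite (_ : (fun n => _) = (fun n => \int[m]_x ((g n x)%:E * (k x)%:E)));
  last first.
  by apply/funext => n; exact: simple.
rewrite -monotone_convergence//.
- apply: eq_integral => x _; apply/cvg_lim => //.
  by apply: cvgeZr => //; exact: gF.
- by move=> n; apply: emeasurable_funM => //; exact/measurable_EFinP.
- by move=> n x _; rewrite mule_ge0// lee_fin.
- by move=> x _ a b ab; rewrite lee_pmul// lee_fin// gnd.
Qed.

End density_measure.

Section joint_law.
Context d1 d2 d3 (Omega : measurableType d1) (S : measurableType d2)
  (S' : measurableType d3) (R : realType).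
Variables (P : probability Omega R) (lambda :
  {sigma_finite_measure set S' -> \bar R}).
Variables (X : Omega -> S) (Y : Omega -> S') (k : Omega * S' -> R).
Hypothesis mX : measurable_fun setT X.
Hypothesis mY : measurable_fun setT Y.
Hypothesis mk : measurable_fun setT k.
Hypothesis k0 : forall z, 0 <= k z.
Local Open Scope ereal_scope.
Hypothesis jointE : forall A B, measurable A -> measurable B ->
  P (X @^-1` A `&` Y @^-1` B) =
  \int[P]_(w in X @^-1` A) \int[lambda]_(y in B) (k (w, y))%:E.

(** The law of [(X, Y)] is the image under [phi] of the measure with density [k]: they agree on
    rectangles, a generating pi-system. The density depends on [w] instead of [X w] because the
    log-partition function will be measurable only along [X]. *)
Lemma ge0_integral_joint (F : S * S' -> \bar R) :
  measurable_fun setT F -> (forall z, 0 <= F z) ->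
  \int[P]_w F (X w, Y w) =
  \int[lambda]_y \int[P]_w (F (X w, y) * (k (w, y))%:E).
Proof.
move=> mF F0.
have [nu nuE] := density_measure_exists (P \x lambda) mk k0.
pose phi (z : Omega * S') : S * S' := (X z.1, z.2).
have mphi : measurable_fun setT phi.
  by apply: measurable_fun_pair => //; exact: measurableT_comp.
pose psi (w : Omega) : S * S' := (X w, Y w).
have mpsi : measurable_fun setT psi by exact: measurable_fun_pair.
have mFphi : measurable_fun setT (F \o phi) by exact: measurableT_comp.
have mkE : measurable_fun setT (fun x => (k x)%:E) by exact/measurable_EFinP.
transitivity (\int[pushforward P psi]_z F z).
  by rewrite ge0_integral_pushforward// preimage_setT.
pose pP := measure_function_pushforward__canonical__measure_function_Measure P mpsi.
pose pnu := measure_function_pushforward__canonical__measure_function_Measure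
  nu mphi.
have Pnu A : measurable A -> pP A = pnu A.
  pose C : set (set (S * S')) := [set A `*` B | A in measurable & B in measurable].
  (* The constant cover by the whole space serves, as the law of [(X, Y)] has mass 1. *)
  apply: (measure_unique C (fun=> setT)) => //.
  - by rewrite measurable_prod_measurableType.
  - move=> _ _ [A1 mA1 [B1 mB1 <-]] [A2 mA2 [B2 mB2 <-]].
    exists (A1 `&` A2); first exact: measurableI.
    by exists (B1 `&` B2); [exact: measurableI|rewrite setXI].
  - by move=> n; exists setT => //; exists setT => //; rewrite setXTT.
  - by rewrite bigcup_const.
  - move=> _ [B mB [D mD <-]].
    rewrite /= /pushforward nuE (_ : phi @^-1` _ = (X @^-1` B) `*` D)//.
    have mXB : measurable (X @^-1` B) by rewrite -[X in measurable X]setTI;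
      exact: mX.
    rewrite (_ : psi @^-1` _ = X @^-1` B `&` Y @^-1` D)// jointE//.
    rewrite [RHS]integral_mkcond fubini_tonelli1//=; last 2 first.
    + apply/measurable_restrict => //; first exact: measurableX.
      by rewrite setTI; exact: measurable_funTS.
    + by move=> z; rewrite patchE; case: ifPn; rewrite ?lee_fin.
    rewrite [LHS]integral_mkcond; apply: eq_integral => w _.
    rewrite /fubini_F patchE; case: ifPn => wB.
      rewrite [LHS]integral_mkcond; apply: eq_integral => y _.
      by rewrite !patchE in_setX/= wB.
    rewrite integral0_eq// => y _.
    by rewrite patchE in_setX/= (negbTE wB).
  - by move=> n; rewrite /= /pushforward preimage_setT probability_setT ltry.
transitivity (\int[pushforward nu phi]_z F z).
  by apply: (eq_measure_integral pnu) => A mA _; exact: Pnu.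
rewrite ge0_integral_pushforward//.
rewrite preimage_setT (ge0_integral_density mk k0 (fun A _ => nuE A) mFphi);
  last first.
  by move=> z; exact: F0.
rewrite fubini_tonelli2//.
- by apply: emeasurable_funM.
- by move=> z; rewrite mule_ge0 ?lee_fin//; exact: F0.
Qed.

End joint_law.

(** * Expectations of possibly nonmeasurable or nonintegrable functions *)

Section nonmeasurable_integral.
Context d (T : measurableType d) (R : realType) (mu : {measure set T -> \bar R}).
Local Open Scope ereal_scope.
Import HBNNSimple.

(* [integral] is a supremum over simple functions, so that altering [f] on a
   negligible set is harmless even when [f] is not measurable. *)
Lemma ae_ge0_le_integral_nonmeasurable (f g : T -> \bar R) :
  (forall x, 0 <= f x) -> (forall x, 0 <= g x) ->
  {ae mu, forall x, f x <= g x} -> \int[mu]_x f x <= \int[mu]_x g x.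
Proof.
move=> f0 g0 [N [mN muN fgN]].
rewrite [leLHS]ge0_integralTE// [leRHS]ge0_integralTE//.
apply: ge_ereal_sup => _ [h hf <-].
(* Cutting [h] off on the exceptional set keeps its integral and puts it below [g]. *)
pose h' : {nnsfun T >-> R} := mul_nnsfun h (indic_nnsfun R (measurableC mN)).
have sE (u : {nnsfun T >-> R}) : sintegral mu u = \int[mu]_x (u x)%:E.
  by rewrite integral_nnsfun// patch_setT.
apply: ereal_sup_ubound; exists h' => [x|].
  rewrite /= mindicE; have [/set_mem/= xN|xN] := boolP (x \in ~` N).
    rewrite mulr1; apply: (le_trans (hf x)).
    by apply: contrapT => /fgN.
  by rewrite mulr0.
rewrite !sE; apply: ge0_ae_eq_integral => //.
- exact/measurable_EFinP.
- exact/measurable_EFinP.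
- by move=> x _; rewrite lee_fin.
- by move=> x _; rewrite lee_fin.
exists N; split => // x /= hh'; apply: contrapT => xN; apply: hh' => _ /=.
by rewrite mindicE mem_set// mulr1.
Qed.

Lemma ae_eq_ge0_integral_nonmeasurable (f g : T -> \bar R) :
  (forall x, 0 <= f x) -> (forall x, 0 <= g x) ->
  {ae mu, forall x, f x = g x} -> \int[mu]_x f x = \int[mu]_x g x.
Proof.
move=> f0 g0 fg; apply/eqP; rewrite eq_le; apply/andP; split;
  apply: ae_ge0_le_integral_nonmeasurable => //;
  by apply: filterS fg => x ->.
Qed.

End nonmeasurable_integral.

(** No integrability is asked: both parts of [f] have measurable integrals by Tonelli, and [fine] is
    measurable whatever it gives at infinity. *)
Lemma measurable_Rintegral {R : realType} d1 d2 (T1 : measurableType d1)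
    (T2 : measurableType d2) (m : {sigma_finite_measure set T1 -> \bar R})
    (f : T1 * T2 -> R) :
  measurable_fun setT f ->
  measurable_fun setT (fun y => \int[m]_x f (x, y))%R.
Proof.
move=> mf; apply: measurableT_comp => //.
rewrite (_ : (fun y => _) = (fun y =>
    \int[m]_x ((EFin \o f)^\+ (x, y)) - \int[m]_x ((EFin \o f)^\- (x, y)))%E);
      last first.
  apply/funext => y; rewrite [LHS]integralE; congr (_ - _)%E.
    by apply: eq_integral => x _; rewrite !funeposE.
  by apply: eq_integral => x _; rewrite !funenegE.
have mfE : measurable_fun setT (EFin \o f) by exact/measurable_EFinP.
apply: emeasurable_funB.
  by apply: (measurable_fun_fubini_tonelli_G ((EFin \o f)^\+)%E) => //;
    exact: measurable_funepos.
by apply: (measurable_fun_fubini_tonelli_G ((EFin \o f)^\-)%E) => //;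
  exact: measurable_funeneg.
Qed.

Section expectation_parts.
Context {R : realType} d (Omega : measurableType d) (P : probability Omega R).

Lemma expectation_max (Z : Omega -> R) : ('E_P[Z] =
  \int[P]_w (Num.max (Z w) 0)%:E - \int[P]_w (Num.max (- Z w) 0)%:E)%E.
Proof.
rewrite unlock integralE; congr (_ - _)%E; apply: eq_integral => w _.
  by rewrite funeposE EFin_max.
by rewrite funenegE EFin_max.
Qed.

(** Meant for [W] an entry of the Jacobian product, whose measurability is not established. *)
Lemma ae_eq_expectation (Z W : Omega -> R) : {ae P, forall w, Z w = W w} ->
  (has_expectation P Z -> has_expectation P W) /\ ('E_P[Z] = 'E_P[W])%E.
Proof.
move=> ZW; rewrite /has_expectation !expectation_max.
have E1 : (\int[P]_w (Num.max (Z w) 0)%:E = \int[P]_w (Num.max (W w) 0)%:E)%E.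
  apply: ae_eq_ge0_integral_nonmeasurable => [w|w|].
  - by rewrite lee_fin le_max lexx orbT.
  - by rewrite lee_fin le_max lexx orbT.
  - by apply: filterS ZW => w ->.
have E2 : (\int[P]_w (Num.max (- Z w) 0)%:E = \int[P]_w (Num.max (- W w) 0)%:E)%E.
  apply: ae_eq_ge0_integral_nonmeasurable => [w|w|].
  - by rewrite lee_fin le_max lexx orbT.
  - by rewrite lee_fin le_max lexx orbT.
  - by apply: filterS ZW => w ->.
by rewrite E1 E2.
Qed.

End expectation_parts.

(** Here [p] and [q] stand for the integrals of two functions, [a] and [b] for those of the positive
    and negative parts of their difference. The bounds make [a] finite when [p] is, and [b] when [q]
    is, so that terms can be moved across. *)
Lemma ge0_subeE {R : realType} (a b p q : \bar R) :
  (0 <= a -> 0 <= b -> 0 <= p -> 0 <= q -> a <= p -> b <= q ->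
  a + q = b + p -> p < +oo \/ q < +oo -> p - q = a - b)%E.
Proof.
case: p => [p| |]; case: q => [q| |]; case: a => [a| |]; case: b => [b| |] //=
  _ _ _ _ _ _; try (by case).
  by move=> [E] _; congr EFin; lra.
all: by move=> _ []; rewrite ltxx.
Qed.

Section integral_pos_part.
Context d (T : measurableType d) (R : realType) (mu : {measure set T -> \bar R}).
Variables (f g : T -> R).
Hypotheses (mf : measurable_fun setT f) (mg : measurable_fun setT g).
Hypotheses (f0 : forall x, 0 <= f x) (g0 : forall x, 0 <= g x).
Local Open Scope ereal_scope.

Lemma integral_pos_part_le :
  \int[mu]_x (Num.max (f x - g x) 0)%:E <= \int[mu]_x (f x)%:E.
Proof.
apply: ge0_le_integral => //.
- by move=> x _; rewrite lee_fin le_max lexx orbT.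
- by apply/measurable_EFinP; apply: measurable_maxr => //; exact: measurable_funB.
- exact/measurable_EFinP.
- by move=> x _; rewrite lee_fin ge_max f0 andbT lerBlDr lerDl.
Qed.

End integral_pos_part.

Lemma integral_pos_partB {R : realType} d (T : measurableType d)
    (mu : {measure set T -> \bar R}) (f g : T -> R) :
  measurable_fun setT f -> measurable_fun setT g ->
  (forall x, 0 <= f x) -> (forall x, 0 <= g x) ->
  (\int[mu]_x (f x)%:E < +oo \/ \int[mu]_x (g x)%:E < +oo)%E ->
  (\int[mu]_x (f x)%:E - \int[mu]_x (g x)%:E =
   \int[mu]_x (Num.max (f x - g x) 0)%:E -
   \int[mu]_x (Num.max (g x - f x) 0)%:E)%E.
Proof.
move=> mf mg f0 g0.
have m1 (u v : T -> R) : measurable_fun setT u -> measurable_fun setT v ->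
    measurable_fun setT (fun x : T => (Num.max (u x - v x) 0 : R)%:E).
  move=> mu_ mv; apply/measurable_EFinP; apply: measurable_maxr => //.
  exact: measurable_funB.
have max0 (r : R) : (0 <= (Num.max r 0)%:E)%E.
  by rewrite lee_fin le_max lexx orbT.
apply: ge0_subeE.
- by apply: integral_ge0 => x _.
- by apply: integral_ge0 => x _.
- by apply: integral_ge0 => x _; rewrite lee_fin.
- by apply: integral_ge0 => x _; rewrite lee_fin.
- exact: integral_pos_part_le.
- exact: integral_pos_part_le.
have mfE : measurable_fun setT (fun x => (f x)%:E) by exact/measurable_EFinP.
have mgE : measurable_fun setT (fun x => (g x)%:E) by exact/measurable_EFinP.
have f0E x : setT x -> (0 <= (f x)%:E)%E by move=> _; rewrite lee_fin.
have g0E x : setT x -> (0 <= (g x)%:E)%E by move=> _; rewrite lee_fin.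
(* What is integrated is the pointwise identity [max (f - g) 0 + g = max (g - f) 0 + f]. *)
rewrite -(ge0_integralD _ measurableT (fun x _ => max0 _) (m1 _ _ mf mg) g0E mgE).
rewrite -(ge0_integralD _ measurableT (fun x _ => max0 _) (m1 _ _ mg mf) f0E mfE).
apply: eq_integral => x _; rewrite -!EFinD; congr EFin.
by rewrite /Num.max; case: ifPn; case: ifPn; lra.
Qed.

(** * The tower property *)

Section conditional_average.
Context d1 d2 d3 (Omega : measurableType d1) (S : measurableType d2)
  (S' : measurableType d3) (R : realType).
Variables (P : probability Omega R) (lambda :
  {sigma_finite_measure set S' -> \bar R}).
Variables (X : Omega -> S) (Y : Omega -> S') (k : Omega * S' -> R).
Hypothesis mX : measurable_fun setT X.
Hypothesis mY : measurable_fun setT Y.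
Hypothesis mk : measurable_fun setT k.
Hypothesis k0 : forall z, 0 <= k z.
Hypothesis jointE : forall A B, measurable A -> measurable B ->
  (P (X @^-1` A `&` Y @^-1` B) =
  \int[P]_(w in X @^-1` A) \int[lambda]_(y in B) (k (w, y))%:E)%E.
Variables (z : S * S' -> R) (V : S' -> R).
Hypothesis mz : measurable_fun setT z.
Hypothesis mV : measurable_fun setT V.
Hypothesis ik : forall y, P.-integrable setT (fun w => (k (w, y))%:E).
Hypothesis iz : forall y,
  P.-integrable setT (fun w => (z (X w, y) * k (w, y))%:E).
Hypothesis VE : forall y, (V y * \int[P]_w k (w, y) =
  \int[P]_w (z (X w, y) * k (w, y)))%R.

Let mkE : measurable_fun setT (EFin \o k).
Proof. exact/measurable_EFinP. Qed.

Let mky y : measurable_fun setT (fun w => k (w, y)).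
Proof. exact: measurableT_comp. Qed.

Let max0 (r : R) : 0 <= Num.max r 0.
Proof. by rewrite le_max lexx orbT. Qed.

(** For [e = 1] and [e = - 1], the integrals of the positive and negative parts of [z] against the
    unnormalized conditional law of [X]; the sign [e] treats both at once. *)
Let part (e : R) (y : S') : R :=
  (\int[P]_w (Num.max (e * z (X w, y)) 0 * k (w, y)))%R.

Let part_integrable e y : `|e| = 1 ->
  P.-integrable setT (fun w => (Num.max (e * z (X w, y)) 0 * k (w, y))%:E).
Proof.
move=> e1; apply: le_integrable (iz y) => //.
  apply/measurable_EFinP; apply: measurable_funM => //.
  apply: measurable_maxr => //; apply: measurable_funM => //.
  by apply: measurableT_comp => //; exact: measurable_fun_pair.
move=> w _; rewrite /= lee_fin !normrM ler_wpM2r//.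
rewrite ger0_norm// ge_max normr_ge0 andbT.
by rewrite (le_trans (ler_norm _))// normrM e1 mul1r.
Qed.

Let joint_part e : `|e| = 1 ->
  (\int[P]_w (Num.max (e * z (X w, Y w)) 0)%:E = \int[lambda]_y (part e y)%:E)%E.
Proof.
move=> e1.
rewrite (ge0_integral_joint mX mY mk k0 jointE
  (F := fun p => (Num.max (e * z p) 0)%:E)).
- apply: eq_integral => y _; rewrite /part fineK//.
  exact: integrable_fin_num (part_integrable y e1).
- apply/measurable_EFinP; apply: measurable_maxr => //.
  exact: measurable_funM.
- by move=> p; rewrite lee_fin.
Qed.

Let measurable_part e : measurable_fun setT (part e).
Proof.
apply: (@measurable_Rintegral _ _ _ _ _ P
  (fun p => Num.max (e * z (X p.1, p.2)) 0 * k p)).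
apply: measurable_funM => //; apply: measurable_maxr => //;
  apply: measurable_funM => //.
apply: measurableT_comp => //; apply: measurable_fun_pair => //.
exact: measurableT_comp.
Qed.

Let joint_V e : `|e| = 1 ->
  (\int[P]_w (Num.max (e * V (Y w)) 0)%:E =
   \int[lambda]_y (Num.max (part e y - part (- e) y) 0)%:E)%E.
Proof.
move=> e1.
rewrite (ge0_integral_joint mX mY mk k0 jointE
  (F := fun p => (Num.max (e * V p.2) 0)%:E)); first last.
- by move=> p; rewrite lee_fin.
- apply/measurable_EFinP; apply: measurable_maxr => //.
  by apply: measurable_funM => //; exact: measurableT_comp.
apply: eq_integral => y _ /=; rewrite ge0_integralZl ?lee_fin//; first last.
- by move=> w _; rewrite lee_fin.
- exact/measurable_EFinP.
have ie := part_integrable y e1.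
have iNe : P.-integrable setT (fun w =>
  (Num.max (- e * z (X w, y)) 0 * k (w, y))%:E).
  by apply: part_integrable; rewrite normrN.
rewrite -[(\int[P]_w _)%E]fineK ?integrable_fin_num//.
(* The mass of [k] enters the maximum, where [VE] turns it into the integral of [z * k], a
   difference of parts. *)
rewrite -[fine _]/(\int[P]_w k (w, y))%R -EFinM maxr_pMl; last first.
  by apply: Rintegral_ge0.
rewrite -mulrA VE mul0r -RintegralZl//; last exact: iz.
rewrite /part -RintegralB//; congr (Num.max _ 0)%:E.
apply: eq_Rintegral => w _; rewrite -mulrBl mulrA; congr (_ * _).
rewrite mulNr; set t := e * _.
by rewrite /Num.max; case: ifPn; case: ifPn; lra.
Qed.

(** Averaging can only cancel: the parts of [V] integrate to at most those of [z], so the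
    expectation of [V] exists. The mass cancelled is the same in both parts, which gives equality
    even when one of them is infinite. *)
Lemma conditional_average :
  has_expectation P (fun w => z (X w, Y w)) ->
  has_expectation P (fun w => V (Y w)) /\
  ('E_P[fun w => z (X w, Y w)] = 'E_P[fun w => V (Y w)])%E.
Proof.
move=> hz.
have eN1 : `|- 1 : R| = 1 by rewrite normrN normr1.
have E1 := joint_part (normr1 R); have E2 := joint_part eN1.
have E3 := joint_V (normr1 R); have E4 := joint_V eN1; rewrite opprK in E4.
have eqm (f g : Omega -> R) : f =1 g ->
    (\int[P]_w (Num.max (f w) 0)%:E = \int[P]_w (Num.max (g w) 0)%:E)%E.
  by move=> fg; apply: eq_integral => w _; rewrite fg.
rewrite (eqm _ _ (fun w => mul1r _)) in E1.
rewrite (eqm _ _ (fun w => mulN1r _)) in E2.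
rewrite (eqm _ _ (fun w => mul1r _)) in E3.
rewrite (eqm _ _ (fun w => mulN1r _)) in E4.
move: hz; rewrite /has_expectation !expectation_max E1 E2 E3 E4 => hz.
have part0 e y : 0 <= part e y.
  by apply: Rintegral_ge0 => w _; exact: mulr_ge0 (max0 _) (k0 _).
split.
  by case: hz => h; [left|right]; apply: le_lt_trans h;
     apply: integral_pos_part_le; (try exact: measurable_part); exact: part0.
by apply: integral_pos_partB => //; (try exact: measurable_part); exact: part0.
Qed.

End conditional_average.

(** * The exponential family *)

Lemma measurable_coord {R : realType} n (i : 'I_n) :
  measurable_fun setT (fun v : 'rV[R]_n => v 0 i).
Proof.
apply: (measurability _ (RGenOpens.measurableE R)) => // _ [_ [a [b ->]] <-].
rewrite setTI; apply: open_measurable_rV; apply: open_comp;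
  last exact: interval_open.
by move=> v _; exact: coord_continuous.
Qed.

Lemma continuous_measurable_rV {R : realType} n (U : set 'rV[R]_n)
    (f : 'rV[R]_n -> R) :
  open U -> {in U, continuous f} -> measurable_fun U f.
Proof.
move=> oU cf.
apply: (measurability _ (RGenOpens.measurableE R)) => // _ [_ [a [b ->]] <-].
suff oA : open (U `&` f @^-1` `]a, b[%classic : set 'rV[R]_n).
  exact: open_measurable_rV.
rewrite openE => y [Uy fy]; apply: filterI.
  exact: open_nbhs_nbhs.
have := cf y (mem_set Uy); apply.
by apply: open_nbhs_nbhs; split => //; exact: interval_open.
Qed.

Lemma ge0_measurable_funV {R : realType} d (T : measurableType d) (f : T -> R) :
  (forall x, 0 <= f x) -> measurable_fun setT f ->
  measurable_fun setT (fun x => (f x)^-1).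
Proof.
move=> f0 mf; under eq_fun do rewrite -(powR_inv1 (f0 _)).
exact: (measurableT_comp (@measurable_powR R (-1)) mf).
Qed.

Section exp_family_conditional.
Context {R : realType} {d : nat} {disp : measure_display}
  {Omega : measurableType disp}.
Variables (P : probability Omega R) (X Y : {RV P >-> 'rV[R]_d}).
Variables (calX calY : set 'rV[R]_d) (h : 'rV[R]_d -> R).
Variables (T : 'rV[R]_d -> 'rV[R]_d) (phi : 'rV[R]_d -> R).
Hypothesis XcalX : forall w, calX (X w).
Hypothesis YcalY : forall w, calY (Y w).
Hypothesis oY : open calY.
Hypothesis h0 : forall y, calY y -> 0 <= h y.
Hypothesis mh : measurable_fun calY h.
Hypothesis aT : analytic_on calY T.
Hypothesis phiE : is_log_partition calX calY h T phi.
Let f := exp_family_pdf h T phi.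
Hypothesis fE : is_conditional_pdf X Y calY f.
Hypothesis regf : regularity P X calX calY f.

Let m := cond_mean P X f.
Let mcalY : measurable calY := open_measurable_rV oY.
Let lambda : {sigma_finite_measure set 'rV[R]_d -> \bar R} := lebesgue_rV d.

(** Extension by 0 outside [calY] makes the joint density measurable on the whole product. *)
Let hp := h \_ calY.
Let Tp (y : 'rV[R]_d) : 'rV[R]_d := \row_a ((fun y => T y 0 a) \_ calY) y.
Let K (w : Omega) := expR (- phi (X w)).
Let k (p : Omega * 'rV[R]_d) := hp p.2 * (K p.1 * expR (dot (X p.1) (Tp p.2))).

Let TpE y : calY y -> Tp y = T y.
Proof. by move=> cy; apply/rowP => a; rewrite mxE patchE mem_set. Qed.

Let hpE y : calY y -> hp y = h y.
Proof. by move=> cy; rewrite /hp patchE mem_set. Qed.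

Let kE w y : calY y -> k (w, y) = f (X w) y.
Proof.
by move=> cy; rewrite /k hpE// TpE// /K -expRD addrC.
Qed.

Let kN w y : ~ calY y -> k (w, y) = 0.
Proof. by move=> cy; rewrite /k /hp patchE memNset// mul0r. Qed.

Let k_ge0 p : 0 <= k p.
Proof.
rewrite /k mulr_ge0 ?mulr_ge0 ?expR_ge0// /hp patchE; case: ifPn => // /set_mem.
exact: h0.
Qed.

Let K0 w : 0 <= K w. Proof. exact: expR_ge0. Qed.

Let mX i : measurable_fun setT (fun w => X w 0 i).
Proof. by apply: (measurableT_comp (measurable_coord i)). Qed.

Let mhp : measurable_fun setT hp.
Proof. by apply/(measurable_restrict _ _ _).1 => //; rewrite setTI. Qed.

Let mTp a : measurable_fun setT (fun y => Tp y 0 a).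
Proof.
rewrite (_ : (fun y => _) = (fun y => T y 0 a) \_ calY); last first.
  by apply/funext => y; rewrite mxE.
apply/(measurable_restrict _ _ _).1 => //; rewrite setTI.
apply: continuous_measurable_rV => // y /set_mem cy.
apply: differentiable_continuous.
have /differentiableP dT := analytic_is_diff (aT cy).
by have /(@ex_diff _ _ _ _ _ _ _) := is_diff_coord a dT.
Qed.

Let mdot : measurable_fun setT (fun p : Omega * 'rV[R]_d => dot (X p.1) (Tp p.2)).
Proof.
apply: measurable_sum => a; apply: measurable_funM.
  exact: (measurableT_comp (mX a)).
exact: (measurableT_comp (mTp a)).
Qed.

Let mexpdot : measurable_fun setT
  (fun p : Omega * 'rV[R]_d => expR (dot (X p.1) (Tp p.2))).
Proof. exact: measurableT_comp. Qed.

(** The normalization in [is_log_partition] recovers [phi (X w)] as the logarithm of a parameter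
    integral, measurable in [w] by Tonelli. *)
Let mK : measurable_fun setT K.
Proof.
have phiXE w : phi (X w) = ln (fine (\int[lambda]_y
  (hp y * expR (dot (X w) (Tp y)))%:E)).
  rewrite (_ : integral _ _ _ = (expR (phi (X w)))%:E) ?expRK//.
  rewrite -(phiE (XcalX w)) [RHS]integral_mkcond; apply: eq_integral => y _.
  rewrite patchE; case: ifPn => [/set_mem cy|cy]; first by rewrite hpE// TpE.
  by rewrite /hp patchE (negbTE cy) mul0r.
apply: measurableT_comp => //; apply: measurable_funN.
under eq_fun do rewrite phiXE.
apply: measurableT_comp => //; apply: measurableT_comp => //.
apply: (measurable_fun_fubini_tonelli_F (m2 := lambda)
  (fun p : Omega * 'rV[R]_d => (hp p.2 * expR (dot (X p.1) (Tp p.2)))%:E)).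
  apply/measurable_EFinP; apply: measurable_funM => //.
  exact: (measurableT_comp mhp).
move=> p; rewrite lee_fin mulr_ge0 ?expR_ge0// /hp patchE.
by case: ifPn => // /set_mem /h0.
Qed.

Let mk : measurable_fun setT k.
Proof.
apply: measurable_funM; first exact: (measurableT_comp mhp).
by apply: measurable_funM => //; exact: (measurableT_comp mK).
Qed.

Let jointE A B : measurable A -> measurable B ->
  (P (X @^-1` A `&` Y @^-1` B) =
  \int[P]_(w in X @^-1` A) \int[lambda]_(y in B) (k (w, y))%:E)%E.
Proof.
move=> mA mB; rewrite (fE mA mB); apply: eq_integral => w _.
rewrite setIC integral_mkcondr; apply: eq_integral => y _.
by rewrite patchE; case: ifPn => [/set_mem /kE ->//|/negP cy];
  rewrite kN// => /mem_set.
Qed.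

Let c y := (\int[P]_w k (w, y))%R.

Let mkw y : measurable_fun setT (fun w => k (w, y)).
Proof. exact: measurableT_comp. Qed.

Let marginalE y : calY y -> marginal_pdf P X f y = (\int[P]_w (k (w, y))%:E)%E.
Proof.
by move=> cy; rewrite /marginal_pdf unlock; apply: eq_integral => w _; rewrite kE.
Qed.

Let k_integrable y : P.-integrable setT (fun w => (k (w, y))%:E).
Proof.
have [cy|cy] := pselect (calY y); last first.
  by rewrite (_ : (fun w => _) = cst 0%E) ?integrable0//; apply/funext => w;
    rewrite kN.
apply/integrableP; split; first exact/measurable_EFinP.
rewrite (le_lt_trans _ (marginal_pdf_fin regf cy))// marginalE//.
rewrite le_eqVlt; apply/orP; left; apply/eqP; apply: eq_integral => w _.
by rewrite gee0_abs// lee_fin.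
Qed.

Let fine_marginal y : calY y -> fine (marginal_pdf P X f y) = c y.
Proof. by move=> cy; rewrite marginalE. Qed.

Let mc : measurable_fun setT c.
Proof. exact: measurable_Rintegral. Qed.

Let M i y := (\int[P]_w (X w 0 i * (k (w, y) / c y)))%R.

Let ME i y : calY y -> m y 0 i = M i y.
Proof.
move=> cy; rewrite mxE /cond_expectation unlock; congr fine.
by apply: eq_integral => w _; rewrite fine_marginal// -kE.
Qed.

Let mM i : measurable_fun setT (M i).
Proof.
apply: (@measurable_Rintegral _ _ _ _ _ P (fun p => X p.1 0 i * (k p / c p.2))).
apply: measurable_funM; first exact: (measurableT_comp (mX i)).
apply: measurable_funM => //.
apply: ge0_measurable_funV; first by move=> p; exact: Rintegral_ge0.
exact: (measurableT_comp mc).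
Qed.

(** This is [k] without the factor [h y], which cancels from conditional averages when [h y > 0]. *)
Let KE y w := K w * expR (dot (X w) (T y)).

Let mKE y : measurable_fun setT (KE y).
Proof. by apply: measurable_funM => //; apply: measurableT_comp => //;
  exact: measurable_dot. Qed.

Let kKE y w : calY y -> k (w, y) = h y * KE y w.
Proof.
move=> cy; rewrite kE// /KE /K /f /exp_family_pdf -expRD.
by rewrite addrC.
Qed.

Let G y := tilted P X K (T y) (cst 1).

Let GE y : G y = (\int[P]_w KE y w)%R.
Proof. by apply: eq_Rintegral => w _; rewrite mul1r. Qed.

Let KE_integrable y : calY y -> 0 < h y ->
  P.-integrable setT (fun w => (KE y w)%:E).
Proof.
move=> cy hy; have := integrableZl measurableT (h y)^-1 (k_integrable y).
apply: eq_integrable => // w _; rewrite -EFinM kKE//.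
by rewrite mulKf// gt_eqF.
Qed.

(** A positive function with integral 0 would vanish almost everywhere, making the whole space
    null. *)
Let G_gt0 y : calY y -> 0 < h y -> 0 < G y.
Proof.
move=> cy hy; rewrite lt_neqAle GE Rintegral_ge0 ?andbT; last first.
  by move=> w _; rewrite mulr_ge0 ?expR_ge0.
apply/eqP => /esym G0.
have : (\int[P]_w `|(KE y w)%:E| = 0)%E.
  rewrite (eq_integral (fun w => (KE y w)%:E)) => [|w _]; last first.
    by rewrite gee0_abs// lee_fin mulr_ge0 ?expR_ge0.
  rewrite -(fineK (integrable_fin_num measurableT (KE_integrable cy hy))).
  by rewrite -[fine _]/(\int[P]_w KE y w)%R G0.
move/ae_eq_integral_abs => /(_ measurableT) [|N [mN PN0 subN]].
  exact/measurable_EFinP.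
have NT : N = setT.
  rewrite -subTset => w _; apply: subN => /= /(_ I) /eqP.
  by rewrite eqe gt_eqF// mulr_gt0 ?expR_gt0.
have /eqP := probability_setT P.
by rewrite -NT PN0 eq_sym onee_eq0.
Qed.

Let cE y : calY y -> 0 < h y -> c y = h y * G y.
Proof.
move=> cy hy; rewrite GE -(RintegralZl _ measurableT (KE_integrable cy hy)).
by apply: eq_Rintegral => w _; rewrite kKE.
Qed.

Let coord_sqr_le w i j : `|X w 0 i * X w 0 j| <= dot (X w) (X w).
Proof.
have D1 (l : 'I_d) : X w 0 l ^+ 2 <= dot (X w) (X w).
  by rewrite /dot (bigD1 l)//= -expr2 lerDl sumr_ge0// => a _;
    rewrite -expr2 sqr_ge0.
have := D1 i; have := D1 j; rewrite -(real_normK (num_real (X w 0 i))).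
rewrite -(real_normK (num_real (X w 0 j))) normrM.
set a := `|X w 0 i|; set b := `|X w 0 j|; set s := dot _ _.
have := sqr_ge0 (a - b); rewrite !expr2; nra.
Qed.

Let dot_ge0 w : 0 <= dot (X w) (X w).
Proof. by apply: sumr_ge0 => a _; rewrite -expr2 sqr_ge0. Qed.

Let mdotXX : measurable_fun setT (fun w => dot (X w) (X w)).
Proof. by apply: measurable_sum => a; apply: measurable_funM. Qed.

(** [cond_norm2_fin] concerns the normalized density [k / c]; multiplication by [G y] turns it into
    [KE]. *)
Let moment_integrable y (u : Omega -> R) C : measurable_fun setT u ->
  calY y -> 0 < h y -> (forall w, `|u w| <= C * (1 + dot (X w) (X w))) ->
  P.-integrable setT (fun w => (u w * KE y w)%:E).
Proof.
move=> mu cy hy uC.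
have i2 : P.-integrable setT (fun w => (dot (X w) (X w) * KE y w)%:E).
  have : P.-integrable setT (fun w => (dot (X w) (X w) * (k (w, y) / c y))%:E).
    have mint : measurable_fun setT (fun w => dot (X w) (X w) * (k (w, y) / c y)).
      by apply: measurable_funM => //; exact: measurable_funM.
    apply/integrableP; split; first exact/measurable_EFinP.
    rewrite (le_lt_trans _ (cond_norm2_fin regf cy))//.
    rewrite /cond_expectation unlock le_eqVlt; apply/orP; left; apply/eqP.
    apply: eq_integral => w _; rewrite gee0_abs; last first.
      by rewrite lee_fin mulr_ge0 ?divr_ge0 ?dot_ge0//; exact: Rintegral_ge0.
    by rewrite fine_marginal// kE// sqr_sqrtr.
  move/(integrableZl measurableT (G y)); apply: eq_integrable => // w _.
  rewrite -EFinM; congr EFin; rewrite cE// kKE//.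
  have h_neq0 : h y != 0 by rewrite gt_eqF.
  have G_neq0 : G y != 0 by rewrite gt_eqF// G_gt0.
  by field; rewrite h_neq0 G_neq0.
have i12 := integrableZl measurableT C
  (integrableD measurableT (KE_integrable cy hy) i2).
apply: le_integrable i12 => //.
  by apply/measurable_EFinP; exact: measurable_funM.
move=> w _; rewrite -EFinD -EFinM /= lee_fin (le_trans _ (ler_norm _))//.
rewrite normrM (ger0_norm (_ : 0 <= KE y w)); last by rewrite mulr_ge0 ?expR_ge0.
rewrite [leRHS](_ : _ = C * (1 + dot (X w) (X w)) * KE y w); last by ring.
by rewrite ler_wpM2r// mulr_ge0 ?expR_ge0.
Qed.

Let X_integrable i y : calY y -> 0 < h y ->
  P.-integrable setT (fun w => (X w 0 i * KE y w)%:E).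
Proof.
move=> cy hy; apply: (@moment_integrable y _ 1) => // w; rewrite mul1r.
have := coord_sqr_le w i i; rewrite normrM -expr2.
set a := `|_|; set s := dot _ _; have := sqr_ge0 (a - 1); rewrite !expr2; nra.
Qed.

Let M_tilted i y : calY y -> 0 < h y ->
  M i y = tilted P X K (T y) (fun w => X w 0 i) / G y.
Proof.
move=> cy hy; rewrite /tilted -(RintegralZr _ measurableT (X_integrable i cy hy)).
apply: eq_Rintegral => w _; rewrite cE// kKE//.
have h_neq0 : h y != 0 by rewrite gt_eqF.
have G_neq0 : G y != 0 by rewrite gt_eqF// G_gt0.
by rewrite /KE; field; rewrite h_neq0 G_neq0.
Qed.

Let z i j (p : 'rV[R]_d * 'rV[R]_d) := (p.1 0 i - M i p.2) * (p.1 0 j - M j p.2).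

Let mz i j : measurable_fun setT (z i j).
Proof.
have mzi a : measurable_fun setT (fun p : 'rV[R]_d * 'rV[R]_d => p.1 0 a - M a p.2).
  apply: measurable_funB; first exact: (measurableT_comp (measurable_coord a)).
  exact: (measurableT_comp (mM a)).
exact: measurable_funM.
Qed.

Let mzX i j y : measurable_fun setT (fun w => z i j (X w, y)).
Proof.
by apply: (measurableT_comp (mz i j)); apply: measurable_fun_pair.
Qed.

Let zKE_integrable i j y : calY y -> 0 < h y ->
  P.-integrable setT (fun w => (z i j (X w, y) * KE y w)%:E).
Proof.
move=> cy hy.
(* The constant comes from expanding [(|X_i| + |M_i|) * (|X_j| + |M_j|)], with [|X_i|] and [|X_j|]
   at most [1 + s] and [|X_i X_j|] at most [s], for [s] the squared Euclidean norm. *)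
apply: (@moment_integrable y _ (1 + `|M i y| + `|M j y| + `|M i y * M j y|)) => //.
move=> w; have Hij := coord_sqr_le w i j.
have Hi := coord_sqr_le w i i; have Hj := coord_sqr_le w j j.
move: Hij Hi Hj; rewrite /z /= !normrM.
have := ler_normB (X w 0 i) (M i y); have := ler_normB (X w 0 j) (M j y).
move: (normr_ge0 (X w 0 i - M i y)) (normr_ge0 (X w 0 j - M j y)).
move: (normr_ge0 (X w 0 i)) (normr_ge0 (X w 0 j)) (normr_ge0 (M i y))
  (normr_ge0 (M j y)).
set a := `|X w 0 i|; set b := `|X w 0 j|; set p := `|M i y|; set q := `|M j y|.
set s := dot _ _; set u := `|_ - _|; set v := `|_ - _|.
move=> a0 b0 p0 q0 u0 v0 vb ua abs aas bbs.
apply: (@le_trans _ _ ((a + p) * (b + q))); first exact: ler_pM.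
have a1 : a <= 1 + s by have := sqr_ge0 (a - 1); rewrite !expr2; nra.
have b1 : b <= 1 + s by have := sqr_ge0 (b - 1); rewrite !expr2; nra.
have s0 : 0 <= s by apply: le_trans aas; exact: mulr_ge0.
have := ler_wpM2r q0 a1; have := ler_wpM2l p0 b1.
have := ler_wpM2l (mulr_ge0 p0 q0) s0.
rewrite !(mulrDl, mulrDr, mulr1, mul1r, mulr0); lra.
Qed.

Let z_integrable i j y : P.-integrable setT
  (fun w => (z i j (X w, y) * k (w, y))%:E).
Proof.
have [cy|cy] := pselect (calY y); last first.
  by rewrite (_ : (fun w => _) = cst 0%E) ?integrable0//; apply/funext => w;
    rewrite kN// mulr0.
have := h0 cy; rewrite le_eqVlt => /predU1P[hy|hy].
  rewrite (_ : (fun w => _) = cst 0%E) ?integrable0//.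
  by apply/funext => w; rewrite kKE// -hy mul0r mulr0.
have := integrableZl measurableT (h y) (zKE_integrable i j cy hy).
by apply: eq_integrable => // w _; rewrite -EFinM kKE// mulrCA.
Qed.

(** The conditional covariance, equal to 0 where [c y = 0]; a measurable stand-in for the Jacobian
    product. *)
Let V i j y := ((\int[P]_w (z i j (X w, y) * k (w, y))) / c y)%R.

Let mV i j : measurable_fun setT (V i j).
Proof.
apply: measurable_funM.
  apply: (@measurable_Rintegral _ _ _ _ _ P (fun p => z i j (X p.1, p.2) * k p)).
  apply: measurable_funM => //; apply: measurableT_comp => //.
  by apply: measurable_fun_pair => //; exact: measurableT_comp.
by apply: ge0_measurable_funV => // y; exact: Rintegral_ge0.
Qed.

(** Where [c y = 0] the left side is 0, and so is the right: as [G] is positive, [c y = 0] forces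
    [h y = 0] or [y] outside [calY], and then [k] vanishes. *)
Let VE i j y : (V i j y * \int[P]_w k (w, y) =
  \int[P]_w (z i j (X w, y) * k (w, y)))%R.
Proof.
have [cy0|c_neq0] := eqVneq (c y) 0; last by rewrite divfK.
have k0 w : k (w, y) = 0.
  have [cy|cy] := pselect (calY y); last by rewrite kN.
  have := h0 cy; rewrite le_eqVlt => /predU1P[hy|hy];
    first by rewrite kKE// -hy mul0r.
  by move: cy0; rewrite cE// => /eqP; rewrite gt_eqF// mulr_gt0// G_gt0.
rewrite -/(c y) cy0 mulr0 /Rintegral integral0_eq// => w _.
by rewrite k0 mulr0.
Qed.

Let V_tilted i j y : calY y -> 0 < h y ->
  V i j y = tilted P X K (T y) (fun w => z i j (X w, y)) / G y.
Proof.
move=> cy hy; rewrite /V cE// (_ : Rintegral _ _ _ = h y * tilted P X K (T y)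
  (fun w => z i j (X w, y))).
  by rewrite -mulf_div divff ?mul1r// gt_eqF.
rewrite /tilted -(RintegralZl _ measurableT (zKE_integrable i j cy hy)).
by apply: eq_Rintegral => w _; rewrite kKE// mulrCA.
Qed.

Let good y := [/\ calY y, 0 < h y & 'J T y \in unitmx].

(** Continuity of a single conditional pdf, contained in [cond_pdf_ac], suffices: it is positive
    exactly where [h] is. *)
Lemma near_pos_density y : calY y -> 0 < h y ->
  \forall x \near y, calY x /\ 0 < h x.
Proof.
move=> cy hy.
(* A space of mass 1 has a point, which supplies an element of [calX]. *)
have [w0] : exists w : Omega, True.
  apply: contrapT => H; have /eqP := probability_setT P.
  rewrite (_ : setT = set0) ?measure0 ?(eq_sym 0%E) ?onee_eq0//.
  by apply/seteqP; split => // w _; apply: H; exists w.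
move=> _; have [cf _] := cond_pdf_ac regf (XcalX w0).
rewrite continuous_open_subspace// in cf.
have fpos x : (0 < f (X w0) x) = (0 < h x) by rewrite pmulr_lgt0 ?expR_gt0.
have : \forall x \near y, 0 < f (X w0) x.
  have /cvgr_gt := cf y (mem_set cy); apply; by rewrite fpos.
have : \forall x \near y, calY x by exact: open_nbhs_nbhs.
by apply: filterS2 => x ? ; rewrite fpos.
Qed.

Lemma good_jacobian y : good y -> differentiable m y /\
  invmx ('J T y) *m 'J m y = \matrix_(i, j) V i j y.
Proof.
move=> [cy hy JT].
have nearU := near_pos_density cy hy.
have [|||||dm JE] := tilted_mean_jacobian (mu := P) (n := d) (X := X) (K := K)
  mX mK K0
    (T := T) (m := m) (y := y).
- exact: analytic_is_diff (aT cy).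
- by [].
- by apply: filterS nearU => x [cx hx]; exact: KE_integrable.
- by rewrite gt_eqF// -/(G y) G_gt0.
- apply: filterS nearU => x [cx hx]; apply/rowP => i.
  by rewrite ME// M_tilted// mxE.
split; [exact: dm|rewrite JE; apply/matrixP => i j].
rewrite [LHS]mxE [RHS]mxE (V_tilted i j cy hy).
by congr (tilted _ _ _ _ _ / _); apply/funext => w; rewrite /z /= !ME.
Qed.

Hypothesis JT : {ae distribution P Y, forall y, 'J T y \in unitmx}.

(** [Y] almost surely avoids the zeros of [h] because the conditional pdf vanishes there. *)
Lemma ae_good : {ae distribution P Y, forall y, good y}.
Proof.
have a1 : {ae distribution P Y, forall y, calY y}.
  exists (~` calY); split => //; first exact: measurableC.
  rewrite /distribution /pushforward (_ : _ @^-1` _ = set0) ?measure0//.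
  by apply/seteqP; split => // w /(_ (YcalY w)).
have a2 : {ae distribution P Y, forall y, calY y -> 0 < h y}.
  exists (calY `&` h @^-1` [set 0]); split.
  - by apply: mh.
  (* The event on [X] is the whole space, so that the joint law yields the law of [Y]. *)
  - rewrite /distribution /pushforward -[X in P X]setTI -[setT](preimage_setT X).
    rewrite fE//; last by apply: mh.
    rewrite integral0_eq// => w _; apply: integral0_eq => y [_ [_ hy]].
    by rewrite /f /exp_family_pdf (hy : h y = 0) mul0r.
  - move=> y /= /not_implyP[cy hy]; split => //.
    by apply/eqP; rewrite eq_le h0// andbT leNgt; exact/negP.
by apply: filterS3 a1 a2 JT => y cy /(_ cy) hy JTy.
Qed.

Lemma ae_differentiable_cond_mean : {ae distribution P Y, forall y,
  differentiable m y}.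
Proof. by apply: filterS ae_good => y /good_jacobian[]. Qed.

(** The tower property is applied to the measurable [V]; its equality with [W] at [good] points then
    transfers the result. *)
Lemma expectation_jacobian i j :
  let Z w := (X w - m (Y w))^T *m (X w - m (Y w)) in
  let W w := invmx ('J T (Y w)) *m 'J m (Y w) in
  has_expectation P (fun w => Z w i j) ->
  has_expectation P (fun w => W w i j) /\
  ('E_P[fun w => Z w i j] = 'E_P[fun w => W w i j])%E.
Proof.
move=> Z W; have -> : (fun w => Z w i j) = (fun w => z i j (X w, Y w)).
  have XmE a w : (X w - m (Y w)) 0 a = X w 0 a - M a (Y w).
    by rewrite mxE [X in _ + X]mxE ME.
  by apply/funext => w; rewrite /Z mxE big_ord1 mxE !XmE.
move/(conditional_average _ _ mk k_ge0 jointE (mz i j) (mV i j) k_integrable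
   (z_integrable i j) (VE i j)) => [//|//|hV ->].
have VW : {ae P, forall w, V i j (Y w) = W w i j}.
  have [N [mN N0 subN]] := ae_good.
  exists (Y @^-1` N); split.
  - by rewrite -[X in measurable X]setTI; apply: measurable_funP.
  - exact: N0.
  move=> w /= VW; apply: subN => /= /good_jacobian[_ E]; apply: VW.
  by rewrite /W E mxE.
by have [hW ->] := ae_eq_expectation VW; split => //; exact: hW.
Qed.

End exp_family_conditional.

Theorem corollary1 (R : realType) (d : nat) (disp : measure_display)
    (Omega : measurableType disp) (P : probability Omega R)
    (X Y : {RV P >-> 'rV[R]_d}) (calX calY : set 'rV[R]_d)
    (h : 'rV[R]_d -> R) (T : 'rV[R]_d -> 'rV[R]_d) (phi : 'rV[R]_d -> R) :
  (forall w, calX (X w)) ->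
  (forall w, calY (Y w)) ->
  open calY ->
  (forall y, calY y -> 0 <= h y) ->
  measurable_fun calY h ->
  analytic_on calY T ->
  is_log_partition calX calY h T phi ->
  is_conditional_pdf X Y calY (exp_family_pdf h T phi) ->
  regularity P X calX calY (exp_family_pdf h T phi) ->
  {ae distribution P Y, forall y, 'J T y \in unitmx} ->
  let m := cond_mean P X (exp_family_pdf h T phi) in
  let Z := fun w => (X w - m (Y w))^T *m (X w - m (Y w)) in
  let W := fun w => invmx ('J T (Y w)) *m 'J m (Y w) in
  {ae distribution P Y, forall y, differentiable m y} /\
  (forall i j : 'I_d, has_expectation P (fun w => Z w i j) ->
     has_expectation P (fun w => W w i j) /\
     MMSE P X (exp_family_pdf h T phi) Y i j = expectation_mx P W i j).
Proof.
move=> XcalX YcalY oY h0 mh aT phiE fE regf JT m Z W; split.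
  exact: (ae_differentiable_cond_mean XcalX YcalY oY h0 mh aT phiE fE regf JT).
move=> i j hZ.
have [hW EZW] := expectation_jacobian XcalX YcalY oY h0 mh aT phiE fE regf JT hZ.
by split => //; rewrite /MMSE /expectation_mx [LHS]mxE [RHS]mxE.
Qed.
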